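(* Let $(\Omega,d,\mu)$ be a locally compact, non-complete metric measure space, with $\mu$ a doubling measure, such that $\Omega$ is a uniform domain in its completion $\overline\Omega$. Suppose also that $\partial\Omega:=\overline\Omega\setminus\Omega$ is equipped with a Borel measure $\nu$ which is codimension $\theta$ Ahlfors regular with respect to $\mu$ for some $\theta>0$. Let $0<\alpha<1$, $1\le p<\infty$, $1\le q\le\infty$ be such that $\alpha+\theta/p<1$. Let $E:B^\alpha_{p,q}(\partial\Omega,\nu)\to B^{\alpha+\theta/p}_{p,q}(\Omega,\mu)$ be the Whitney extension operator with cutoff and let $T:HB^{\alpha+\theta/p}_{p,q}(\Omega,\mu)\to HB^{\alpha}_{p,q}(\partial\Omega,\nu)$ be the trace operator (both described in the context). Then $T\circ E=\mathrm{Id}$; that is, for each $f\in B^\alpha_{p,q}(\partial\Omega,\nu)$ we have $TEf(z)=f(z)$ for $\nu$-a.e. $z\in\partial\Omega$.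
   Context: Doubling: a Borel measure $\mu$ on a metric space is doubling if there is $C_\mu\ge 1$ with $0<\mu(B(x,2r))\le C_\mu\,\mu(B(x,r))<\infty$ for all points $x$ and all $r>0$. Boundary: $\overline\Omega$ is the metric completion of $\Omega$; since $\Omega$ is locally compact it is open in $\overline\Omega$. The measure $\mu$ is extended to $\overline\Omega$ by zero. Balls $B(z,r)$ centered at $z\in\partial\Omega$ are balls of $\overline\Omega$. Codimension $\theta$ Ahlfors regularity: there is $C_\theta\ge 1$ such that for all $z\in\partial\Omega$ and $0<r\le 2\operatorname{diam}(\partial\Omega)$, $$\frac{1}{C_\theta}\frac{\mu(B(z,r)\cap\Omega)}{r^\theta}\le\nu(B(z,r)\cap\partial\Omega)\le C_\theta\frac{\mu(B(z,r)\cap\Omega)}{r^\theta}.$$ Uniform domain: a curve is a continuous map $\gamma:[a,b]\to X$ (identified with its image). A domain (connected open set) $\Omega\subset X$ is uniform if for some $A\ge1$, every $x,y\in\Omega$ can be joined by a curve $\gamma$ in $\Omega$ with (i) $\operatorname{diam}(\gamma)\le A\,d(x,y)$, and (ii) for each $z\in\gamma$, $\min\{\operatorname{diam}(\gamma_{x,z}),\operatorname{diam}(\gamma_{z,y})\}\le A\,\operatorname{dist}(z,X\setminus\Omega)$, where $\gamma_{x,z}$, $\gamma_{z,y}$ are the subcurves with the indicated endpoints. Here $X=\overline\Omega$. Besov spaces: for a metric measure space $(X,d,\mu)$, $0<\alpha<1$, $1\le p<\infty$ and $f\in L^1_{\mathrm{loc}}(X,\mu)$, set $$\|f\|_{HB^\alpha_{p,q}(X,\mu)}:=\left(\int_0^\infty\left(\int_X\frac{1}{\mu(B(x,t))}\int_{B(x,t)}|f(y)-f(x)|^p\,d\mu(y)\,d\mu(x)\right)^{q/p}\frac{dt}{t^{\alpha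 q+1}}\right)^{1/q}$$ for $1\le q<\infty$, and $$\|f\|_{HB^\alpha_{p,\infty}(X,\mu)}:=\sup_{t>0}\frac{1}{t^{\alpha}}\left(\int_X\frac{1}{\mu(B(x,t))}\int_{B(x,t)}|f(y)-f(x)|^p\,d\mu(y)\,d\mu(x)\right)^{1/p}.$$ $HB^\alpha_{p,q}(X,\mu)$ is the class of $f\in L^1_{\mathrm{loc}}(X,\mu)$ for which this seminorm is finite, and $B^\alpha_{p,q}(X,\mu):=HB^\alpha_{p,q}(X,\mu)\cap L^p(X,\mu)$. Trace operator $T$: the bounded linear operator $T:HB^{\alpha+\theta/p}_{p,q}(\Omega,\mu)\to HB^{\alpha}_{p,q}(\partial\Omega,\nu)$ determined $\nu$-a.e. by $$\lim_{r\to 0^+}\frac{1}{\mu(B(z,r))}\int_{B(z,r)}|u-Tu(z)|^p\,d\mu=0\quad\text{for }\nu\text{-a.e. }z\in\partial\Omega.$$ Extension operator $E$: fix a countable Whitney cover $\{B_{i,j}=B(p_{i,j},r_{i,j})\}$ of $\Omega$ in $\overline\Omega$ by balls in $\Omega$ such that (i) $\bigcup_{i,j}B_{i,j}=\Omega$; (ii) $\sum_{i,j}\chi_{2B_{i,j}}\le 2C_\mu^5$; (iii) $2^{i-1}<r_{i,j}\le 2^i$ for all $i\in\mathbb Z$; (iv) $r_{i,j}=\frac18\operatorname{dist}(p_{i,j},\partial\Omega)$; (v) for each $i$ the points $\{p_{i,j}\}_j$ are $2^i/C$-separated (so for each $K\ge1$ there is $C_K\ge1$ with $\sum_j\chi_{KB_{i,j}}\le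 C_K$); together with a partition of unity $\{\varphi_{i,j}\}$ with $\varphi_{i,j}$ being $C/r_{i,j}$-Lipschitz, $0\le\varphi_{i,j}\le\chi_{2B_{i,j}}$ and $\sum_{i,j}\varphi_{i,j}=\chi_\Omega$, where $C$ depends only on $C_\mu$. Let $q_{i,j}\in\partial\Omega$ be a closest point to $p_{i,j}$, and $U_{i,j}:=B(q_{i,j},r_{i,j})\cap\partial\Omega$. Set $$\widetilde Ef(x):=\sum_{i,j}\left(\frac{1}{\nu(U_{i,j})}\int_{U_{i,j}}f\,d\nu\right)\varphi_{i,j}(x),\quad x\in\Omega.$$ Let $\Phi:\Omega\to[0,1]$ be a $1$-Lipschitz function with $\Phi\equiv1$ on $\{x\in\Omega:\operatorname{dist}(x,\partial\Omega)\le1\}$ and $\Phi\equiv0$ on $\{x\in\Omega:\operatorname{dist}(x,\partial\Omega)>2\}$. Then $Ef:=\Phi\,\widetilde Ef$. *)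

(* Defs.v *)
From HB Require Import structures.
From mathcomp Require Import all_boot all_order all_algebra.
From mathcomp Require Import all_classical all_reals all_analysis.
Set Implicit Arguments.
Unset Strict Implicit.
Unset Printing Implicit Defensive.
Import Order.TTheory GRing.Theory Num.Theory.
Import numFieldNormedType.Exports.
Local Open Scope classical_set_scope.
Local Open Scope ring_scope.

#[short(type="completeMetricType")]
HB.structure Definition CompleteMetric (K : numDomainType) :=
  { M of CompletePseudoMetric K M & PseudoMetric_isMetric K M }.

Notation borel X := (g_sigma_algebraType (@open X)).

(* For types that, like set_type A, carry no canonical point. *)
Definition complete_space (T : uniformType) : Prop :=
  forall F : set_system T, ProperFilter F -> cauchy F -> exists x : T, F --> x.

Section MetricSets.
Context {R : realType} {X : completeMetricType R}.
Implicit Types (A S Omega : set X).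

(* X plays the role of the completion of its dense subset Omega. *)
Definition bdry Omega : set X := ~` Omega.

Definition diam A : \bar R :=
  ereal_sup [set (mdist xy.1 xy.2)%:E | xy in A `*` A].

Definition dist_to (x : X) A : R := inf [set mdist x y | y in A].

Definition lipschitz_in A (L : R) (f : X -> R) : Prop :=
  forall x y, A x -> A y -> `|f x - f y| <= L * mdist x y.

Definition uniform_curve Omega (A : R) (x y : X) (a b : R) (g : R -> X) : Prop :=
  [/\ {within `[a, b], continuous g},
      g a = x /\ g b = y,
      g @` `[a, b] `<=` Omega,
      (diam (g @` `[a, b]) <= (A * mdist x y)%:E)%E &
      forall t, t \in `[a, b] ->
        (Order.min (diam (g @` `[a, t])) (diam (g @` `[t, b]))
          <= (A * dist_to (g t) (~` Omega))%:E)%E].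

Definition uniform_domain Omega : Prop :=
  [/\ open Omega, connected Omega &
      exists2 A : R, 1 <= A &
        forall x y, Omega x -> Omega y ->
          exists a b (g : R -> X), a <= b /\ uniform_curve Omega A x y a b g].

End MetricSets.

(* A subset S of X, with the restricted metric and measure, is a metric measure
   space whose balls are the sets ball x r `&` S; functions on S are represented
   by functions on X, of which only the values on S matter. *)
Section MetricMeasure.
Context {R : realType} {X : completeMetricType R}.
Implicit Types (S Omega : set X) (m mu nu : {measure set (borel X) -> \bar R}).
Implicit Types (f u : X -> R).

Local Open Scope ereal_scope.

Definition doubling m S (C : R) : Prop :=
  (1 <= C)%R /\
  forall x (r : R), S x -> (0 < r)%R ->
    [/\ 0 < m (ball x (2 * r) `&` S),
        m (ball x (2 * r) `&` S) <= C%:E * m (ball x r `&` S) &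
        C%:E * m (ball x r `&` S) < +oo].

Definition codim_regular mu nu Omega (theta : R) : Prop :=
  exists2 C : R, (1 <= C)%R &
    forall z (r : R), bdry Omega z -> (0 < r)%R ->
      r%:E <= 2%:E * diam (bdry Omega) ->
      (C^-1 / r `^ theta)%:E * mu (ball z r `&` Omega)
        <= nu (ball z r `&` bdry Omega) /\
      nu (ball z r `&` bdry Omega)
        <= (C / r `^ theta)%:E * mu (ball z r `&` Omega).

Definition L1loc m S f : Prop :=
  measurable_fun (S : set (borel X)) (f : borel X -> R) /\
  forall x, S x -> exists2 r : R, (0 < r)%R &
    m.-integrable (ball x r `&` S) (EFin \o f).

Definition Lp m S (p : R) f : Prop :=
  measurable_fun (S : set (borel X)) (f : borel X -> R) /\
  \int[m]_(x in S) ((`|f x| `^ p)%R)%:E < +oo.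

Definition besov_energy m S (p : R) f (t : R) : \bar R :=
  \int[m]_(x in S)
    ((m (ball x t `&` S))^-1 *
     \int[m]_(y in ball x t `&` S) ((`|f y - f x| `^ p)%R)%:E).

(* Only used for 1 <= q; the value at -oo is a dummy. *)
Definition besov_seminorm m S (alpha p : R) (q : \bar R) f : \bar R :=
  match q with
  | q%:E =>
      (\int[@lebesgue_measure R]_(t in `]0%R, +oo[)
         (besov_energy m S p f t `^ (q / p) *
          ((t `^ (alpha * q + 1))^-1)%:E)) `^ q^-1
  | +oo =>
      ereal_sup [set ((t `^ alpha)^-1)%:E * besov_energy m S p f t `^ p^-1
                | t in [set t : R | (0 < t)%R]]
  | -oo => 0
  end.

Definition hom_besov m S (alpha p : R) (q : \bar R) f : Prop :=
  L1loc m S f /\ besov_seminorm m S alpha p q f < +oo.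

Definition besov m S (alpha p : R) (q : \bar R) f : Prop :=
  hom_besov m S alpha p q f /\ Lp m S p f.

Definition trace_value mu (p : R) u (z : X) (c : R) : Prop :=
  (mu (ball z r))^-1 * \int[mu]_(x in ball z r) ((`|u x - c| `^ p)%R)%:E
    @[r --> (0 : R)^'+] --> 0.

(* The value at z of the trace T u: the real number determined by the limit.
   The value +oo marks the points where no number is determined, so that
   trace mu p u z = c%:E entails trace_value mu p u z c.  For u in the domain
   of T this happens only on a nu-null subset of the boundary. *)
Definition trace mu (p : R) u (z : X) : \bar R :=
  xget +oo [set c%:E | c in trace_value mu p u z].

End MetricMeasure.

Section WhitneyExtension.
Context {R : realType} {X : completeMetricType R}.

(* The ball B_{i,j} has index k = (i, j), and windex is the set of the indices
   that occur.  The balls of X used here lie in Omega, because their radii are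
   at most a quarter of the distance to the boundary. *)
Record whitney (Omega : set X) (Cmu C : R) := Whitney {
  windex : set (int * nat) ;
  wcenter : int * nat -> X ;
  wradius : int * nat -> R ;
  wfun : int * nat -> X -> R ;
  wnear : int * nat -> X ;
  wC_gt0 : 0 < C ;
  wcenter_in : forall k, windex k -> Omega (wcenter k) ;
  wcover : \bigcup_(k in windex) ball (wcenter k) (wradius k) = Omega ;
  woverlap : forall x,
    (\esum_(k in windex) (\1_(ball (wcenter k) (2 * wradius k)) x)%:E
      <= (2 * Cmu ^+ 5)%:E)%E ;
  wradius_scale : forall k, windex k ->
    2 ^ (k.1 - 1) < wradius k <= 2 ^ k.1 ;
  wradiusE : forall k, windex k ->
    wradius k = 8^-1 * dist_to (wcenter k) (bdry Omega) ;
  wseparated : forall i j j', windex (i, j) -> windex (i, j') -> j != j' ->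
    2 ^ i / C <= mdist (wcenter (i, j)) (wcenter (i, j')) ;
  wfun_lipschitz : forall k, windex k ->
    lipschitz_in Omega (C / wradius k) (wfun k) ;
  wfun_bound : forall k, windex k -> forall x,
    0 <= wfun k x <= \1_(ball (wcenter k) (2 * wradius k)) x ;
  wfun_sum : forall x,
    (\esum_(k in windex) (wfun k x)%:E = (\1_Omega x)%:E)%E ;
  wnear_in : forall k, windex k -> bdry Omega (wnear k) ;
  wnear_dist : forall k, windex k ->
    mdist (wcenter k) (wnear k) = dist_to (wcenter k) (bdry Omega) }.

Definition cutoff (Omega : set X) (Phi : X -> R) : Prop :=
  [/\ forall x, Omega x -> 0 <= Phi x <= 1,
      lipschitz_in Omega 1 Phi,
      forall x, Omega x -> dist_to x (bdry Omega) <= 1 -> Phi x = 1 &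
      forall x, Omega x -> 2 < dist_to x (bdry Omega) -> Phi x = 0].

Variables (Omega : set X) (Cmu C : R) (W : whitney Omega Cmu C).
Variable nu : {measure set (borel X) -> \bar R}.

Definition wshadow (k : int * nat) : set X :=
  ball (wnear W k) (wradius W k) `&` bdry Omega.

Definition waverage (f : X -> R) (k : int * nat) : R :=
  (fine (nu (wshadow k)))^-1 * \int[nu]_(y in wshadow k) f y.

(* By woverlap, the sum has finitely many nonzero terms at each point. *)
Definition whitney_ext0 (f : X -> R) (x : X) : R :=
  \sum_(k \in windex W) waverage f k * wfun W k x.

Definition whitney_ext (Phi f : X -> R) (x : X) : R :=
  Phi x * whitney_ext0 f x.

End WhitneyExtension.

(* Main.v *)
From HB Require Import structures.
Require Import Defs.
From mathcomp Require Import all_boot all_order all_algebra.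
From mathcomp Require Import all_classical all_reals all_analysis.
From mathcomp Require Import measurable_realfun.
From mathcomp Require finmap.
From mathcomp Require Import ring lra zify.
Set Implicit Arguments.
Unset Strict Implicit.
Unset Printing Implicit Defensive.
Import Order.TTheory GRing.Theory Num.Theory.
Import numFieldNormedType.Exports.
Local Open Scope classical_set_scope.
Local Open Scope ring_scope.

(** Write S for the boundary, u for the extension of f and g(z,t) for the mean
    of |f - f(z)|^p over the ball B(z,t) of S, its oscillation at scale t.  The
    proof shows that u has trace f(z) at every z with g(z,2^-n) -> 0, and that
    this happens for nu-almost every z.

    Small oscillations almost everywhere ([oscillation_cvg0]).  The integral of
    g(.,t) over S is the Besov energy at scale t.  Finiteness of the seminorm
    and doubling of nu bound it by a multiple of t^(alpha p)
    ([energy_decay]), for finite q because the energies at scales between t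
    and 2t are comparable.  The energies at the scales 2^-n are therefore
    summable; so is g(z,2^-n) for almost every z, and its terms tend to 0.
    Tonelli's theorem needs g(.,t) to be measurable in z; this holds because S
    is separable, the boundary points nearest to the Whitney centres being
    dense in it.

    Trace at a point of small oscillation ([trace_whitney_ext]).  Near z the
    cutoff is 1 and u(x) is a convex combination of averages of f over shadows
    U_k with x in 2B_k.  One of them is at least as far from f(z) as u(x) is
    ([whitney_ext0_dominated]), so by Jensen's inequality |u - f(z)|^p is
    bounded by the sum over k of the indicator of 2B_k times the mean of
    |f - f(z)|^p over U_k.  Integrating this sum for mu gives the integral for
    nu of |f - f(z)|^p against the sum of the weights mu(2B_k)/nu(U_k) of the
    shadows that contain a point.  By codimension regularity and bounded
    overlap, the balls of radius about 2^i contribute at most a constant times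
    2^(i theta) to that sum ([wweight_sum]), and the geometric series over the
    scales below 2^-n, comparable to the radius r, is at most a constant times
    2^(-n theta) ([integral_whitney_majorant]).  Regularity once more turns
    this into a bound of the mean of |u - f(z)|^p over B(z,r) by a multiple of
    g(z,2^-n) ([integral_majorant_le]).

    That sum is also a measurable majorant of |u - f(z)|^p with small means,
    which forces f(z) to be the only possible trace value ([trace_eq]).

    If S is a single point z, its diameter is 0 and regularity carries no
    information; but then all averages equal f(z) unless nu(S) = 0. *)

(** * Metric balls and Borel sets *)

Section MetricLemmas.
Context {R : realType} {X : completeMetricType R}.
Implicit Types (A S Omega : set X).

Lemma ballP (x y : X) (r : R) : ball x r y <-> mdist x y < r.
Proof. by rewrite ballEmdist. Qed.

Lemma open_ballm (x : X) (r : R) : open (ball x r).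
Proof.
rewrite openE => y /ballP xyr.
apply/nbhs_ballP; exists (r - mdist x y); first by rewrite /= subr_gt0.
move=> w /ballP yw; apply/ballP.
have := metric_triangle x y w; lra.
Qed.

Lemma sub_ballm (x y : X) (r s : R) : mdist x y + r <= s -> ball y r `<=` ball x s.
Proof.
move=> xyrs w /ballP yw; apply/ballP.
have := metric_triangle x y w; lra.
Qed.

Lemma measurable_open (A : set X) : open A -> measurable (A : set (borel X)).
Proof. by move=> oA; apply: sub_sigma_algebra. Qed.

Lemma measurable_ballm (x : X) (r : R) : measurable (ball x r : set (borel X)).
Proof. exact: measurable_open (open_ballm x r). Qed.

Lemma measurable_bdry Omega : open Omega ->
  measurable (bdry Omega : set (borel X)).
Proof. by move=> oO; apply: measurableC; exact: measurable_open. Qed.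

Lemma dist_to_le (x z : X) A : A z -> dist_to x A <= mdist x z.
Proof.
move=> Az; apply: ge_inf; last by exists z.
by exists 0 => _ [y _ <-]; exact: mdist_ge0.
Qed.

Lemma mdist_le_diam A (x y : X) : A x -> A y -> ((mdist x y)%:E <= diam A)%E.
Proof. by move=> Ax Ay; apply: ereal_sup_ubound; exists (x, y). Qed.

Lemma dense_ball Omega (z : X) (r : R) : dense Omega -> 0 < r ->
  exists2 x, Omega x & mdist z x < r.
Proof.
move=> dO r0; have [||x [/ballP zx Ox]] := dO (ball z r); last by exists x.
- by exists z; apply/ballP; rewrite mdistxx.
- exact: open_ballm.
Qed.

End MetricLemmas.

(** * Integrals, means and series *)

Section LowerIntegral.
Context d (T : measurableType d) (R : realType).
Variable m : {measure set T -> \bar R}.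
Local Open Scope ereal_scope.

(** The integral of a nonnegative function, measurable or not, is a supremum
    over the simple functions below it, hence monotone. *)
Lemma le_lower_integral (D : set T) (f g : T -> \bar R) :
  (forall x, D x -> 0 <= f x) -> (forall x, D x -> f x <= g x) ->
  \int[m]_(x in D) f x <= \int[m]_(x in D) g x.
Proof.
move=> f0 fg; have g0 x : D x -> 0 <= g x.
  by move=> Dx; apply: le_trans (fg _ Dx); exact: f0.
rewrite !ge0_integralE//; apply: le_ereal_sup => _ [h hf <-].
by exists h => // x; apply: le_trans (hf x) _; exact: lee_restrict.
Qed.

End LowerIntegral.

Section Series.
Context {R : realType}.
Local Open Scope ereal_scope.

Lemma nneseries_term_le (u : nat -> \bar R) n :
  (forall k, 0 <= u k) -> u n <= \sum_(k <oo) u k.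
Proof.
move=> u0; apply: le_trans (nneseries_lim_ge (m := 0%N) n.+1 _) => //.
by rewrite big_nat_recr//= leeDr// sume_ge0.
Qed.

Lemma nneseries_le (u : nat -> \bar R) (M : \bar R) :
  (forall k, 0 <= u k) -> (forall n, \sum_(0 <= k < n) u k <= M) ->
  \sum_(k <oo) u k <= M.
Proof.
move=> u0 uM; apply: lime_le; first exact: is_cvg_nneseries.
by apply: nearW => n; exact: uM.
Qed.

Lemma nneseries_geometric_le (a z : R) : (0 <= a)%R -> (0 <= z < 1)%R ->
  \sum_(k <oo) (a * z ^+ k)%:E <= (a / (1 - z))%:E.
Proof.
move=> a0 /andP[z0 z1]; apply: nneseries_le => [k|n].
  by rewrite lee_fin mulr_ge0// exprn_ge0.
rewrite sumEFin lee_fin.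
have := congr1 (fun s => s n) (@geometric_seriesE R a z (negbT (lt_eqF z1))).
rewrite /series /= => ->; rewrite ler_pM2r ?invr_gt0 ?subr_gt0//.
by rewrite ler_piMr// gerBl exprn_ge0.
Qed.

End Series.

Section DyadicPowers.
Context {R : realType}.

Lemma dyadic_between (t : R) : 0 < t <= 1 ->
  exists n, t <= (2 ^+ n)^-1 < 2 * t.
Proof.
move=> /andP[t0 t1].
have ex : exists n, (2 ^+ n)^-1 < 2 * t.
  exists (Num.truncn (2 * t)^-1).+1.
  rewrite invf_plt ?posrE ?exprn_gt0 ?mulr_gt0//; apply: (lt_trans (truncnS_gt _)).
  by rewrite -natrX ltr_nat ltn_expl.
have [[|n] hn nmin] := ex_minnP ex.
  by exists 0%N; rewrite expr0 invr1 in hn *; rewrite t1.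
exists n.+1; rewrite hn andbT leNgt; apply/negP => nt.
have : (n.+1 <= n)%N; last by rewrite ltnn.
by apply: nmin; rewrite exprS invfM in nt *; lra.
Qed.

Lemma powR_half_lt1 (b : R) : 0 < b -> 2^-1 `^ b < 1.
Proof.
move=> b0; have : 2^-1 `^ b < 1 `^ b :> R.
  by apply: gt0_ltr_powR; rewrite ?nnegrE ?invr_ge0// invf_lt1// ltr1n.
by rewrite powR1.
Qed.

Lemma powR_exprn (x b : R) n : 0 <= x -> (x ^+ n) `^ b = (x `^ b) ^+ n.
Proof. by move=> x0; rewrite -!powR_mulrn ?powR_ge0// -!powRrM mulrC. Qed.

End DyadicPowers.

Section PowerMean.
Context {R : realType}.

(** Young's inequality for s and a^(p-1), rearranged: the convex function s^p
    lies above its tangent line at a. *)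
Lemma powR_tangent (p a s : R) : 1 <= p -> 0 <= a -> 0 <= s ->
  a `^ p + p * a `^ (p - 1) * s <= s `^ p + p * a `^ (p - 1) * a.
Proof.
move=> p1 a0 s0; have [->|pN1] := eqVneq p 1.
  by rewrite subrr !powRr0 !powRr1// !mul1r addrC.
have {pN1}p1 : 1 < p by rewrite lt_neqAle eq_sym pN1.
have p0 : 0 < p by lra.
have [q_gt0 pq] : 0 < p / (p - 1) /\ p^-1 + (p / (p - 1))^-1 = 1.
  split; first by apply: divr_gt0; lra.
  by rewrite invf_div; field; rewrite gt_eqF.
have := conjugate_powR s0 (powR_ge0 a (p - 1)) p0 q_gt0 pq.
have pp1 : (p - 1) * (p / (p - 1)) = p by field; rewrite subr_eq0 gt_eqF.
have aE : a `^ (p - 1) * a = a `^ p.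
  have [->|aN0] := eqVneq a 0; first by rewrite mulr0 powR0// gt_eqF.
  by rewrite -[X in _ * X]powRr1// -powRD ?aN0 ?implybT// subrK.
rewrite -powRrM pp1 invf_div => h.
have := ler_wpM2l (ltW p0) h.
rewrite mulrDr [p * (s `^ p / p)]mulrC divfK ?gt_eqF//.
rewrite (_ : p * (a `^ p * ((p - 1) / p)) = a `^ p * (p - 1)); last first.
  by field; rewrite gt_eqF.
rewrite -!mulrA aE; lra.
Qed.

Context d (T : measurableType d) (m : {measure set T -> \bar R}).
Local Open Scope ereal_scope.

(** Jensen's inequality for s^p: integrate the tangent inequality at the mean
    of g. *)
Lemma powR_mean_le (A : set T) (v p : R) (g : T -> R) :
  measurable A -> m A = v%:E -> (0 < v)%R -> (1 <= p)%R ->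
  measurable_fun A g -> (forall x, A x -> (0 <= g x)%R) ->
  m.-integrable A (EFin \o g) ->
  ((v^-1 * \int[m]_(x in A) g x) `^ p)%:E <=
  v^-1%:E * \int[m]_(x in A) ((g x `^ p)%R)%:E.
Proof.
move=> mA mAv v0 p1 mg g0 ig.
set I := Rintegral m A g; pose a := (v^-1 * I)%R.
have I0 : (0 <= I)%R by exact: Rintegral_ge0.
have a0 : (0 <= a)%R by rewrite mulr_ge0// invr_ge0 ltW.
pose b := (p * a `^ (p - 1))%R.
have b0 : (0 <= b)%R by rewrite mulr_ge0 ?powR_ge0//; lra.
have gE : \int[m]_(x in A) (g x)%:E = I%:E.
  by rewrite /I /Rintegral fineK//; exact: (integrable_fin_num mA ig).
have mgE : measurable_fun A (fun x => (g x)%:E) by exact/measurable_EFinP.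
have mgp : measurable_fun A (fun x => ((g x `^ p)%R)%:E).
  apply/measurable_EFinP; exact: (measurableT_comp (measurable_powR p) mg).
have lhsE : \int[m]_(x in A) ((a `^ p)%:E + b%:E * (g x)%:E)
    = (a `^ p * v + b * I)%:E.
  rewrite ge0_integralD//; last 3 first.
  - by move=> x _; rewrite lee_fin powR_ge0.
  - by move=> x Ax; rewrite -EFinM lee_fin mulr_ge0 ?g0.
  - exact: measurable_funeM.
  by rewrite integral_cst// mAv ge0_integralZl_EFin// gE.
have rhsE : \int[m]_(x in A) (((g x `^ p)%R)%:E + (b * a)%:E)
    = \int[m]_(x in A) ((g x `^ p)%R)%:E + (b * a * v)%:E.
  rewrite ge0_integralD//; last 2 first.
  - by move=> x _; rewrite lee_fin powR_ge0.
  - by move=> x Ax; rewrite lee_fin mulr_ge0.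
  by rewrite integral_cst// mAv.
have : (a `^ p * v + b * I)%:E
    <= \int[m]_(x in A) ((g x `^ p)%R)%:E + (b * a * v)%:E.
  rewrite -lhsE -rhsE; apply: le_lower_integral => x Ax.
    by rewrite -EFinM -EFinD lee_fin addr_ge0 ?powR_ge0// mulr_ge0// g0.
  by rewrite -EFinM -!EFinD lee_fin powR_tangent// g0.
have -> : (b * a * v = b * I)%R.
  by rewrite /a; field; rewrite gt_eqF.
rewrite EFinD leeD2rE// => h.
rewrite -[leLHS]mul1e -[1]/(1%:E) -(mulVf (lt0r_neq0 v0)) EFinM -muleA.
by apply: lee_wpmul2l; rewrite ?lee_fin ?invr_ge0 ?(ltW v0)// -EFinM mulrC.
Qed.

End PowerMean.

Lemma average_le {R : realType} (m I : \bar R) (e : R) : (0 < m < +oo)%E ->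
  (m^-1 * I <= e%:E)%E = (I <= e%:E * m)%E.
Proof.
case: m => [m| |]/andP[]//; rewrite lte_fin => m0 _.
by rewrite inver gt_eqF// muleC lee_pdivrMr.
Qed.

(** * Majorants determine the trace *)

Section TraceCriterion.
Context {R : realType} {X : completeMetricType R}.
Variables (Omega : set X) (mu : {measure set (borel X) -> \bar R}).
Variables (p : R).
Hypotheses (Omega_open : open Omega) (mu_ext0 : mu (~` Omega) = 0%E).
Hypothesis p_ge1 : 1 <= p.

Local Open Scope ereal_scope.

(** Adding +oo off the conull set Omega turns M into a majorant of g on all of
    B without changing its integral; g itself may fail to be measurable. *)
Lemma le_lower_integral_domain (B : set X) (g M : X -> \bar R) :
  measurable (B : set (borel X)) ->
  measurable_fun (setT : set (borel X)) (M : borel X -> \bar R) ->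
  (forall x, 0 <= M x) -> (forall x, B x -> 0 <= g x) ->
  (forall x, B x -> Omega x -> g x <= M x) ->
  \int[mu]_(x in B) g x <= \int[mu]_(x in B) M x.
Proof.
move=> mB mM M0 g0 gM.
have mC : measurable (~` Omega : set (borel X)).
  by apply: measurableC; exact: measurable_open.
have mI : measurable_fun (B : set (borel X))
    (fun x : borel X => (\1_(~` Omega) x : R)%:E).
  by apply/measurable_EFinP; exact: measurable_indic.
have I0 x : 0 <= (\1_(~` Omega) x : R)%:E by rewrite lee_fin.
apply: (@le_trans _ _
  (\int[mu]_(x in B) (M x + +oo * (\1_(~` Omega) x : R)%:E))).
  apply: le_lower_integral => // x Bx.
  have [Ox|nOx] := pselect (Omega x).
    by rewrite indicE memNset ?mule0 ?adde0; [exact: gM|exact].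
  rewrite indicE mem_set// mule1 addey ?leey//.
  by rewrite -ltNye; apply: lt_le_trans (M0 x); rewrite ltNy0.
rewrite ge0_integralD//; last 2 first.
- exact: measurable_funTS mM.
- exact: measurable_funeM.
rewrite ge0_integralZl// integral_indic//.
suff -> : mu (~` Omega `&` B) = 0 by rewrite mule0 adde0.
by apply: subset_measure0 mu_ext0; [exact: measurableI| |move=> x []].
Qed.

Definition small_majorant (u : X -> R) (z : X) (c e r : R) : Prop :=
  exists M : X -> \bar R,
    [/\ measurable_fun (setT : set (borel X)) (M : borel X -> \bar R),
        forall x, 0 <= M x,
        forall x, ball z r x -> Omega x -> ((`|u x - c| `^ p)%R)%:E <= M x &
        \int[mu]_(x in ball z r) M x <= e%:E * mu (ball z r)].

(** A measurable majorant of the deviation from c with small averages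
    determines the trace: it bounds the averages from above, and by Markov's
    inequality u stays away from any other value on most of a small ball. *)
Lemma trace_eq (u : X -> R) (z : X) (c : R) :
  (forall r : R, (0 < r)%R -> 0 < mu (ball z r) < +oo) ->
  (forall e : R, (0 < e)%R ->
     \forall r \near (0 : R)^'+, small_majorant u z c e r) ->
  trace mu p u z = c%:E.
Proof.
move=> mu_fin maj.
have p0 : (0 < p)%R by apply: lt_le_trans p_ge1.
have r_pos : \forall r \near (0 : R)^'+, (0 < r)%R by exact: nbhs_right_gt.
apply: xget_unique => [|y [c' tc' <-]].
  exists c => //; rewrite /trace_value.
  have avg_le (e : R) : (0 < e)%R -> \forall r \near (0 : R)^'+,
      0 <= (mu (ball z r))^-1
           * \int[mu]_(x in ball z r) ((`|u x - c| `^ p)%R)%:E <= e%:E.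
    move=> e0; near=> r.
    have r0 : (0 < r)%R by near: r.
    have /andP[m0 moo] := mu_fin r r0.
    have [M [mM M0 uM IM]] : small_majorant u z c e r by near: r; exact: maj.
    rewrite mule_ge0 ?inve_ge0//=; last first.
      by apply: integral_ge0 => x _; rewrite lee_fin powR_ge0.
    rewrite average_le ?m0//.
    apply: le_trans IM; apply: le_lower_integral_domain => //.
    exact: measurable_ballm.
  apply/fine_cvgP; split.
    have := avg_le 1%R ltr01; apply: filterS => r /andP[h0 h1].
    by rewrite ge0_fin_numE//; apply: le_lt_trans h1 _; rewrite ltry.
  apply/cvgrPdist_le => e e0.
  have := avg_le e e0; apply: filterS => r /andP[h0 h1] /=.
  rewrite sub0r normrN ger0_norm ?fine_ge0//.
  rewrite -lee_fin fineK//.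
  by rewrite ge0_fin_numE//; apply: le_lt_trans h1 _; rewrite ltry.
congr EFin; apply/eqP/negPn/negP => cc'.
(* At the points of the ball where M < k, u is closer to c than to c', so its
   deviation from c' is at least k; these points fill most of the ball. *)
pose k : R := ((`|c' - c| / 2) `^ p)%R.
have k0 : (0 < k)%R by rewrite powR_gt0// divr_gt0// normr_gt0 subr_eq0.
have k4 : (0 < k / 4)%R by lra.
have small : \forall r \near (0 : R)^'+, (mu (ball z r))^-1
    * \int[mu]_(x in ball z r) ((`|u x - c'| `^ p)%R)%:E <= (k / 4)%:E.
  have /fine_cvgP[fin cv] := tc'.
  near=> r.
  have finr : (mu (ball z r))^-1
    * \int[mu]_(x in ball z r) ((`|u x - c'| `^ p)%R)%:E \is a fin_num by near: r.
  rewrite -(fineK finr) lee_fin.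
  have : (`|0 - fine ((mu (ball z r))^-1
    * \int[mu]_(x in ball z r) ((`|u x - c'| `^ p)%R)%:E)| <= k / 4)%R.
    by near: r; move/cvgrPdist_le : cv => /(_ _ k4).
  by rewrite sub0r normrN; apply: le_trans; exact: ler_norm.
suff : \forall r \near (0 : R)^'+, False.
  by move=> /filter_ex[].
near=> r.
have r0 : (0 < r)%R by near: r.
have /andP[m0 moo] := mu_fin r r0.
have mB := measurable_ballm z r.
have mfin : mu (ball z r) \is a fin_num by rewrite ge0_fin_numE.
have : (mu (ball z r))^-1
    * \int[mu]_(x in ball z r) ((`|u x - c'| `^ p)%R)%:E <= (k / 4)%:E by near: r.
rewrite average_le ?m0// => hc'.
have [M [mM M0 uM IM]] : small_majorant u z c (k / 4) r by near: r; exact: maj.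
pose E : set (borel X) := Omega `&` [set x | M x < k%:E].
have mE : measurable E.
  apply: measurableI; first exact: measurable_open.
  rewrite -[X in measurable X]setTI.
  exact: emeasurable_fun_infty_o.
have mkE : measurable_fun (setT : set (borel X))
    (fun x : borel X => k%:E * (\1_E x)%:E).
  by apply: measurable_funeM; apply/measurable_EFinP; exact: measurable_indic.
have kE0 x : 0 <= k%:E * (\1_E x)%:E :> \bar R.
  by rewrite mule_ge0// lee_fin ltW.
have h1 : k%:E * mu (ball z r)
    <= \int[mu]_(x in ball z r) (k%:E * (\1_E x)%:E + M x).
  rewrite -integral_cst//; apply: le_lower_integral_domain => //.
  - exact: emeasurable_funD.
  - by move=> x; rewrite adde_ge0.
  - by move=> x _; rewrite lee_fin ltW.
  move=> x Bx Ox; have [Mk|kM] := ltP (M x) k%:E.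
    by rewrite indicE mem_set// mule1 leeDl.
  by apply: le_trans kM _; rewrite leeDr.
have h2 : \int[mu]_(x in ball z r) (k%:E * (\1_E x)%:E)
    <= \int[mu]_(x in ball z r) ((`|u x - c'| `^ p)%R)%:E.
  apply: le_lower_integral => [//|x Bx].
  have [[Ox Mx]|Ex] := pselect (E x); last first.
    by rewrite indicE memNset// mule0 lee_fin powR_ge0.
  rewrite indicE mem_set// mule1 lee_fin.
  have := le_lt_trans (uM _ Bx Ox) Mx; rewrite lte_fin => ux.
  have {}ux : (`|u x - c| < `|c' - c| / 2)%R.
    rewrite ltNge; apply/negP => h; move: ux; rewrite ltNge => /negP; apply.
    by apply: ge0_ler_powR; rewrite ?nnegrE ?(ltW p0)// divr_ge0.
  apply: ge0_ler_powR; rewrite ?nnegrE ?(ltW p0) ?divr_ge0//.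
  have := ler_distD (u x) c' c; rewrite (distrC c' (u x)); lra.
rewrite ge0_integralD// in h1; last 2 first.
- exact: measurable_funTS mkE.
- exact: measurable_funTS mM.
have h3 := le_trans h1 (leeD (le_trans h2 hc') IM).
move: h3; rewrite -(fineK mfin) -!EFinM -EFinD lee_fin.
have f0 : (0 < fine (mu (ball z r)))%R by rewrite fine_gt0// m0.
set t := fine _ in f0 *; nra.
Unshelve. all: by end_near. Qed.

End TraceCriterion.

(** * Pointwise estimates for Whitney extensions *)

Section WhitneyExtensions.
Context {R : realType} {X : completeMetricType R}.
Variables (Omega : set X) (nu : {measure set (borel X) -> \bar R}).
Variables (Cmu C : R) (W : whitney Omega Cmu C) (Phi : X -> R).
Hypotheses (Omega_open : open Omega) (Omega_dense : dense Omega).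
Hypothesis Phi_cutoff : cutoff Omega Phi.

Local Notation S := (bdry Omega).

(** Empty for an index that does not occur, so that sums run over all indices. *)
Definition wball2 (k : int * nat) : set X :=
  [set x | windex W k /\ ball (wcenter W k) (2 * wradius W k) x].

Lemma measurable_wball2 k : measurable (wball2 k : set (borel X)).
Proof.
have [Wk|Wk] := pselect (windex W k).
  rewrite (_ : wball2 k = ball (wcenter W k) (2 * wradius W k)).
    exact: measurable_ballm.
  by apply/seteqP; split => [x []|x].
by rewrite (_ : wball2 k = set0)//; apply/seteqP; split => // x [].
Qed.

Lemma measurable_wshadow k : measurable (wshadow W k : set (borel X)).
Proof.
by apply: measurableI; [exact: measurable_ballm|exact: measurable_bdry].
Qed.

Lemma exprz2_gt0 (i : int) : 0 < (2 : R) ^ i.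
Proof. exact: exprz_gt0. Qed.

Lemma wradius_gt0 k : windex W k -> 0 < wradius W k.
Proof. by move=> /wradius_scale/andP[+ _]; apply: lt_trans; exact: exprz2_gt0. Qed.

Lemma wradius_le k : windex W k -> wradius W k <= 2 ^ k.1.
Proof. by move=> /wradius_scale/andP[]. Qed.

Lemma wradius_gt k : windex W k -> 2 ^ k.1 < 2 * wradius W k.
Proof.
move=> /wradius_scale/andP[+ _]; rewrite expfzDr ?pnatr_eq0//.
rewrite (_ : (2 : R) ^ (-1) = 2^-1)//; lra.
Qed.

Lemma wnearE k : windex W k -> mdist (wcenter W k) (wnear W k) = 8 * wradius W k.
Proof. by move=> Wk; rewrite wnear_dist// wradiusE//; lra. Qed.

(** The balls of one scale are part of a cover of bounded overlap. *)
Lemma wball2_scale_overlap (i : int) (x : X) :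
  (\sum_(j <oo) (\1_(wball2 (i, j)) x)%:E <= (2 * Cmu ^+ 5)%:E)%E.
Proof.
rewrite nneseries_esumT; last by move=> j; rewrite lee_fin.
apply: le_trans (woverlap W x).
pose P := [set j | windex W (i, j)].
pose F k := (\1_(ball (wcenter W k) (2 * wradius W k)) x : R)%:E.
apply: (@le_trans _ _ (\esum_(k in [set (i, j) | j in P]) F k)%E).
  rewrite esum_image; last by move=> j k _ _ [].
  rewrite [leRHS]esum_mkcond; apply: le_esum => j _; rewrite /F.
  case: ifPn => [/set_mem Pj|/negP Pj].
    rewrite lee_fin !indicE ler_nat.
    case: (boolP (x \in wball2 _)) => [/set_mem[_ ?]|//]; by rewrite mem_set.
  rewrite indicE memNset// => -[Wj _]; apply: Pj; exact: mem_set.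
rewrite esum_mkcond [leRHS]esum_mkcond; apply: le_esum => k _.
case: ifPn => [/set_mem[j Pj <-]|_]; first by rewrite mem_set.
by case: ifPn => // _; rewrite lee_fin.
Qed.

(** The Whitney balls near a boundary point are small, so the boundary points
    nearest to their centres are close to it; in particular the boundary is
    separable. *)
Lemma wnear_dense z (e : R) : S z -> 0 < e ->
  exists2 k, windex W k & mdist z (wnear W k) < e.
Proof.
move=> Sz e0; have e3 : 0 < e / 3 by lra.
have [x Ox zx] := dense_ball z Omega_dense e3.
have [k Wk /ballP kx] :
    (\bigcup_(k in windex W) ball (wcenter W k) (wradius W k)) x.
  by rewrite wcover.
exists k => //.
have := dist_to_le (wcenter W k) Sz; have := wradiusE Wk.
have := wnearE Wk; have := metric_triangle (wcenter W k) x z.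
have := metric_triangle z x (wnear W k).
have := metric_triangle x (wcenter W k) (wnear W k).
rewrite (metric_sym x (wcenter W k)) (metric_sym x z); lra.
Qed.

Lemma bdry_sequence x : S x -> exists a : nat -> X, (forall n, S (a n)) /\
  forall z (e : R), S z -> 0 < e -> exists n, mdist z (a n) < e.
Proof.
move=> Sx.
(* The points wnear k, in the order of the codes of k; a code that belongs to
   no Whitney ball is sent to x. *)
pose a n := if unpickle n is Some k then
  (if `[< windex W k >] then wnear W k else x) else x.
exists a; split=> [n|z e Sz e0].
  rewrite /a; case: unpickle => // k; case: asboolP => // Wk.
  exact: wnear_in.
have [k Wk zk] := wnear_dense Sz e0.
by exists (pickle k); rewrite /a pickleK; case: asboolP.
Qed.

Lemma wfun_out k x : windex W k -> ~ wball2 k x -> wfun W k x = 0.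
Proof.
move=> Wk xk; have := wfun_bound Wk x.
rewrite indicE memNset; last by move=> bx; apply: xk.
by move=> h; apply/eqP; rewrite eq_le andbC.
Qed.

Lemma wfun_ge0 k x : windex W k -> 0 <= wfun W k x.
Proof. by move=> /wfun_bound/(_ x)/andP[]. Qed.

Section ConvexCombination.
Import finmap.finmap.

Lemma finite_wball2 (x : X) : finite_set [set k | wball2 k x].
Proof.
apply: contrapT => infF.
pose M : R := 2 * Cmu ^+ 5.
have [B BF Bn] := infinite_set_fset (Num.truncn M).+1 infF.
have : (((Num.truncn M).+1%:R : R)%:E <= M%:E)%E.
  apply: le_trans (woverlap W x); apply: esum_ge.
  exists [set` B]; first by split => // k /BF[].
  rewrite fsbig_finite//= set_fsetK.
  under eq_big_seq => k kB.
    have [_ xk] := BF k kB; rewrite indicE mem_set//; over.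
  rewrite sumEFin lee_fin big_const_seq iter_addr_0 count_predT ler_nat.
  exact: Bn.
by rewrite lee_fin leNgt truncnS_gt.
Qed.

(** On the domain the extension is a convex combination of averages, so one of
    the averages lies at least as far from c as the extension does. *)
Lemma whitney_ext0_dominated (f : X -> R) (x : X) (c : R) : Omega x ->
  exists2 k, wball2 k x &
    `|whitney_ext0 W nu f x - c| <= `|waverage W nu f k - c|.
Proof.
move=> Ox; set F := [set k | wball2 k x].
have finF : finite_set F by exact: finite_wball2.
have FW : F `<=` windex W by move=> k [].
have sum1 : \sum_(k \in F) wfun W k x = 1.
  apply: EFin_inj; rewrite -fsumEFin//.
  rewrite -esum_fset//; last first.
    by move=> k /set_mem/FW Wk; rewrite lee_fin wfun_ge0.
  transitivity (\esum_(k in windex W) (wfun W k x)%:E)%E; last first.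
    by rewrite wfun_sum indicE mem_set.
  rewrite esum_mkcond [RHS]esum_mkcond; apply: eq_esum => k _.
  case: ifPn => [/set_mem/FW Wk|/negP Fk]; first by rewrite mem_set.
  case: ifPn => // /set_mem Wk; rewrite wfun_out// => xk.
  by apply: Fk; exact: mem_set.
have extE : whitney_ext0 W nu f x = \sum_(k \in F) waverage W nu f k * wfun W k x.
  rewrite /whitney_ext0; apply/esym/fsbig_widen => // k [Wk Fk] /=.
  by rewrite wfun_out// mulr0.
set D := whitney_ext0 W nu f x - c.
have DE : D = \sum_(k \in F) (waverage W nu f k - c) * wfun W k x.
  rewrite /D extE -[c in LHS]mulr1 -sum1 mulr_fsumr.
  rewrite !fsbig_finite//= -sumrB; apply: eq_bigr => k _; ring.
apply: contrapT => noK.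
have lt_dev k : F k -> `|waverage W nu f k - c| < `|D|.
  by move=> Fk; rewrite ltNge; apply/negP => h; apply: noK; exists k.
have h : \sum_(k \in F) (`|D| - `|waverage W nu f k - c|) * wfun W k x <= 0.
  have -> : \sum_(k \in F) (`|D| - `|waverage W nu f k - c|) * wfun W k x =
    `|D| * \sum_(k \in F) wfun W k x
      - \sum_(k \in F) `|waverage W nu f k - c| * wfun W k x.
    rewrite mulr_fsumr !fsbig_finite//= -sumrB; apply: eq_bigr => k _; ring.
  rewrite sum1 mulr1 subr_le0 {1}DE !fsbig_finite//=.
  apply: le_trans (ler_norm_sum _ _ _) _.
  rewrite big_seq [leRHS]big_seq; apply: ler_sum => k.
  rewrite in_fset_set// => /set_mem/FW Wk.
  by rewrite normrM (ger0_norm (wfun_ge0 x Wk)).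
have f0 k : F k -> wfun W k x = 0.
  move=> Fk; have Wk := FW k Fk.
  have t0 j : F j -> 0 <= (`|D| - `|waverage W nu f j - c|) * wfun W j x.
    by move=> Fj; rewrite mulr_ge0 ?wfun_ge0 ?subr_ge0 ?ltW ?lt_dev//; exact: FW.
  have : (`|D| - `|waverage W nu f k - c|) * wfun W k x <= 0.
    apply: le_trans h; rewrite fsbig_finite//= (big_fsetD1 k)/=; last first.
      by rewrite in_fset_set// mem_set.
    rewrite lerDl big_seq; apply: sumr_ge0 => j.
    by rewrite !inE => /andP[_]; rewrite in_fset_set// => /set_mem/t0.
  rewrite pmulr_rle0 ?subr_gt0 ?lt_dev// => le0.
  by apply/eqP; rewrite eq_le le0 wfun_ge0.
have : \sum_(k \in F) wfun W k x = 0 by apply: fsbig1 => k Fk; exact: f0.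
by rewrite sum1 => /eqP; rewrite oner_eq0.
Qed.

End ConvexCombination.

Definition shadow_average (h : X -> R) (k : int * nat) : \bar R :=
  ((nu (wshadow W k))^-1 * \int[nu]_(y in wshadow W k) (h y)%:E)%E.

(** Jensen's inequality, unless the right-hand side is infinite; if it is
    finite, f is integrable on the shadow, which has finite measure. *)
Lemma waverage_dev_le (p c : R) (f : X -> R) k :
  windex W k -> 1 <= p -> (0 < nu (wshadow W k) < +oo)%E ->
  measurable_fun (S : set (borel X)) (f : borel X -> R) ->
  ((`|waverage W nu f k - c| `^ p)%:E
    <= shadow_average (fun y => (`|f y - c| `^ p)%R) k)%E.
Proof.
move=> Wk p1; set U := wshadow W k; move=> /andP[nU0 nUoo] mf.
have mU : measurable (U : set (borel X)) by exact: measurable_wshadow.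
have p0 : 0 < p by apply: lt_le_trans p1.
have nUE : nu U = (fine (nu U))%:E by rewrite fineK// ge0_fin_numE.
have v0 : 0 < fine (nu U) by rewrite -lte_fin -nUE.
set v := fine (nu U) in nUE v0.
rewrite /shadow_average -/U nUE inver gt_eqF//.
have mfU : measurable_fun (U : set (borel X)) (f : borel X -> R).
  apply: measurable_funS mf; [exact: measurable_bdry|exact: subIsetr].
pose g (y : borel X) : R := `|f y - c|.
have mfc : measurable_fun (U : set (borel X)) (fun y : borel X => f y - c).
  by apply: measurable_funB.
have mg : measurable_fun (U : set (borel X)) g.
  exact: (measurableT_comp (@normr_measurable R setT) mfc).
have mgp : measurable_fun (U : set (borel X)) (fun y => g y `^ p).
  exact: (measurableT_comp (measurable_powR p) mg).
set I := (\int[nu]_(y in U) _)%E.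
have I0 : (0 <= I)%E by apply: integral_ge0 => y _; rewrite lee_fin powR_ge0.
have [Ioo|Ioo] := eqVneq I +oo%E.
  by rewrite Ioo gt0_muley ?leey// lte_fin invr_gt0.
have {}Ioo : (I < +oo)%E by rewrite ltey.
have ig : nu.-integrable (U : set (borel X)) (EFin \o g).
  apply/integrableP; split; first exact/measurable_EFinP.
  apply: (@le_lt_trans _ _ (\int[nu]_(y in U) (1%:E + (g y `^ p)%:E))%E).
    apply: le_lower_integral => // y _.
    rewrite /= -EFinD lee_fin ger0_norm; last by rewrite /g.
    have [g1|g1] := leP (g y) 1.
      by apply: le_trans g1 _; rewrite lerDl powR_ge0.
    rewrite -[leLHS]powRr1; last by rewrite /g.
    apply: le_trans (ler_powR _ p1) _; first exact: ltW.
    by rewrite lerDr.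
  rewrite ge0_integralD//; last 2 first.
  - by move=> y _; rewrite lee_fin powR_ge0.
  - exact/measurable_EFinP.
  by rewrite integral_cst// mul1e lte_add_pinfty.
have ifc : nu.-integrable (U : set (borel X))
    (EFin \o (fun y : borel X => f y - c)).
  apply/integrableP; split; first exact/measurable_EFinP.
  move: (ig) => /integrableP[_]; apply: le_lt_trans.
  by apply: le_lower_integral => // y _ /=; rewrite lee_fin normr_id.
have ic : nu.-integrable (U : set (borel X)) (EFin \o (fun=> c)).
  apply/integrableP; split; first by apply/measurable_EFinP.
  by rewrite /= integral_cst// nUE -EFinM ltry.
have g0 y : U y -> 0 <= g y by move=> _; exact: normr_ge0.
apply: le_trans (powR_mean_le mU nUE v0 p1 mg g0 ig).
rewrite lee_fin; apply: ge0_ler_powR; rewrite ?nnegrE ?(ltW p0)//.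
  rewrite mulr_ge0 ?invr_ge0 ?(ltW v0)//.
  by apply: Rintegral_ge0 => y _; exact: normr_ge0.
have -> : waverage W nu f k - c = v^-1 * \int[nu]_(y in U) (f y - c).
  rewrite /waverage -/U -/v.
  have -> : \int[nu]_(y in U) f y = \int[nu]_(y in U) ((f y - c) + c).
    by apply: eq_Rintegral => y _; rewrite subrK.
  rewrite RintegralD// Rintegral_cst// -/v mulrDr mulrCA mulVf ?gt_eqF// mulr1.
  by rewrite addrK.
rewrite normrM ger0_norm ?invr_ge0 ?(ltW v0)//.
by rewrite ler_wpM2l ?invr_ge0 ?(ltW v0)//; exact: le_normr_Rintegral.
Qed.

Lemma whitney_ext_near (f : X -> R) x z : Omega x -> S z -> mdist x z <= 1 ->
  whitney_ext W nu Phi f x = whitney_ext0 W nu f x.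
Proof.
move=> Ox Sz xz; have [_ _ Phi1 _] := Phi_cutoff.
by rewrite /whitney_ext Phi1 ?mul1r//; apply: le_trans xz; exact: dist_to_le.
Qed.

(** The radius is an eighth of the distance from the centre to the boundary, so
    8 r_k <= d(p_k,z) <= 2 r_k + d(x,z). *)
Lemma wball2_small k x z r : wball2 k x -> S z -> mdist z x < r ->
  6 * wradius W k < r.
Proof.
move=> [Wk /ballP kx] Sz zx.
have := dist_to_le (wcenter W k) Sz.
have := metric_triangle (wcenter W k) x z; rewrite (metric_sym x z).
have := wradiusE Wk; lra.
Qed.

(** From z to x, to the centre of the ball, to its nearest boundary point, to y:
    at most r + (2 + 8 + 1) r_k, with 6 r_k < r. *)
Lemma wshadow_sub k x z r : wball2 k x -> S z -> mdist z x < r ->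
  wshadow W k `<=` ball z (4 * r).
Proof.
move=> kx Sz zx y [/ballP qy _]; apply/ballP.
have rk := wball2_small kx Sz zx; have [Wk /ballP cx] := kx.
have := metric_triangle z x y; have := metric_triangle x (wcenter W k) y.
have := metric_triangle (wcenter W k) (wnear W k) y; rewrite wnearE//.
rewrite (metric_sym x (wcenter W k)); have := mdist_ge0 z x; lra.
Qed.

Lemma wradius_level k n : windex W k -> 2 * wradius W k <= (2 ^+ n)^-1 ->
  exists m, k.1 = - (n + m)%:Z.
Proof.
move=> Wk hr; have := wradius_gt Wk => /lt_le_trans/(_ hr).
rewrite exprnP invr_expz ltr_eXz2l ?ltr1n// => kn.
exists (`|k.1| - n)%N; lia.
Qed.

End WhitneyExtensions.

(** * Besov functions have small oscillations almost everywhere *)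

Section Oscillation.
Context {R : realType} {X : completeMetricType R}.
Variables (S : set X) (nu : {measure set (borel X) -> \bar R}).
Variables (r0 p : R) (a : nat -> X) (f : X -> R).
Hypothesis mS : measurable (S : set (borel X)).
Hypothesis aS : forall n, S (a n).
Hypothesis a_dense : forall z (e : R), S z -> 0 < e ->
  exists n, mdist z (a n) < e.
Hypothesis r0_gt0 : 0 < r0.
Hypothesis nu_fin : forall z (r : R), S z -> 0 < r -> r <= r0 ->
  (0 < nu (ball z r `&` S) < +oo)%E.
Hypothesis f_meas : measurable_fun (S : set (borel X)) (f : borel X -> R).

Local Open Scope ereal_scope.

(** The integrand of the Besov energy at scale t. *)
Definition oscillation (t : R) (z : X) : \bar R :=
  (nu (ball z t `&` S))^-1
    * \int[nu]_(y in ball z t `&` S) ((`|f y - f z| `^ p)%R)%:E.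

Lemma oscillation_ge0 t z : 0 <= oscillation t z.
Proof.
by rewrite mule_ge0 ?inve_ge0//; apply: integral_ge0 => y _; rewrite lee_fin powR_ge0.
Qed.

Let near_pairs (t : R) : set (borel X * borel X) :=
  [set zy | [/\ S zy.1, S zy.2 & (mdist zy.1 zy.2 < t)%R]].

(** In a separable space the metric is measurable for the product of the Borel
    sigma-algebras: a point of the dense sequence close to one of two nearby
    points witnesses their nearness. *)
Let measurable_near_pairs t : measurable (near_pairs t).
Proof.
have -> : near_pairs t = \bigcup_n \bigcup_m
    ((ball (a n) m.+1%:R^-1 `&` S) `*` (ball (a n) (t - m.+1%:R^-1) `&` S)).
  apply/seteqP; split => [[z y] [/= Sz Sy zy]|[z y]].
    have e0 : (0 < (t - mdist z y) / 2)%R by lra.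
    have [m] : exists m, (m.+1%:R^-1 < (t - mdist z y) / 2 :> R)%R.
      exists (Num.truncn ((t - mdist z y) / 2)^-1)%R.
      rewrite invf_plt ?posrE ?ltr0n//; exact: truncnS_gt.
    move=> hm; have m0 : (0 < m.+1%:R^-1 :> R)%R by rewrite invr_gt0 ltr0n.
    have [n zn] := a_dense Sz m0.
    exists n => //; exists m => //=; split; split => //; apply/ballP.
      by rewrite metric_sym.
    have := metric_triangle (a n) z y; rewrite (metric_sym (a n) z).
    set e := (m.+1%:R^-1)%R in hm zn *; lra.
  move=> [n _ [m _ [/= [/ballP nz Sz] [/ballP ny Sy]]]]; split => //=.
  have := metric_triangle z (a n) y; rewrite (metric_sym z (a n)).
  set e := (m.+1%:R^-1)%R in nz ny *; lra.
apply: bigcupT_measurable => n; apply: bigcupT_measurable => m.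
by apply: measurableX; apply: measurableI => //; exact: measurable_ballm.
Qed.

(** Countably many small balls centred at the dense sequence cover S. *)
Let sigma_finite_restr : sigma_finite setT (mrestr nu mS).
Proof.
pose F n : set (borel X) := if n is n'.+1 then ball (a n') r0 `&` S else ~` S.
exists F.
  apply/esym; apply/seteqP; split => // x _.
  have [Sx|Sx] := pselect (S x); last by exists 0%N.
  have [n xn] := a_dense Sx r0_gt0.
  by exists n.+1 => //; split => //; apply/ballP; rewrite metric_sym.
case=> [|n]; split; rewrite /F /mrestr.
- exact: measurableC.
- by rewrite setICl measure0.
- by apply: measurableI => //; exact: measurable_ballm.
- rewrite -setIA setIid.
  by have /andP[] := nu_fin (aS n) r0_gt0 (lexx r0).
Qed.

Let nuS : {sigma_finite_measure set (borel X) -> \bar R} :=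
  HB.pack_for (SigmaFiniteMeasure.type (borel X) R) (mrestr nu mS)
    (Measure_isSigmaFinite.Build _ (borel X) R (mrestr nu mS) sigma_finite_restr).

Let fS : borel X -> R := (f : borel X -> R) \_ S.

Let fS_meas : measurable_fun setT fS.
Proof. by move/(measurable_restrictT _ mS) : f_meas. Qed.

(** Tonelli's theorem for the restriction of nu to S, the domain of integration
    being a section of near_pairs. *)
Let measurable_ball_integral (G : R -> R) (t : R) :
  measurable_fun setT G -> (forall x, 0 <= G x)%R ->
  measurable_fun (S : set (borel X)) (fun z : borel X =>
    \int[nu]_(y in ball z t `&` S) (G (f y - f z))%:E).
Proof.
move=> mG G0.
pose F (zy : borel X * borel X) : \bar R :=
  (G (fS zy.2 - fS zy.1) * \1_(near_pairs t) zy)%:E.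
have mF : measurable_fun setT F.
  apply/measurable_EFinP; apply: measurable_funM.
    apply: (measurableT_comp mG); apply: measurable_funB.
      exact: measurableT_comp fS_meas measurable_snd.
    exact: measurableT_comp fS_meas measurable_fst.
  by apply: measurable_indic; exact: measurable_near_pairs.
have F0 zy : 0 <= F zy by rewrite lee_fin mulr_ge0.
have := @measurable_fun_fubini_tonelli_F _ _ (borel X) (borel X) R nuS F mF F0.
move=> /(@measurable_funTS _ _ (borel X) _ S).
apply: eq_measurable_fun => z /set_mem Sz.
rewrite /fubini_F.
have mB : measurable (ball z t `&` S : set (borel X)).
  by apply: measurableI => //; exact: measurable_ballm.
transitivity (\int[nuS]_(y in ball z t `&` S) (G (f y - f z))%:E); last first.
  apply: eq_measure_integral => A mA AB /=; rewrite /mrestr.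
  by congr (nu _); apply/setIidl => y /AB[].
rewrite [RHS]integral_mkcond; apply: eq_integral => y _.
rewrite patchE /F indicE /=.
case: ifPn => [/set_mem[/ballP zy Sy]|/negP nzy].
  rewrite mem_set ?mulr1; last by split.
  by rewrite /fS !patchE !mem_set.
rewrite memNset ?mulr0// => -[/= _ Sy zy]; apply: nzy; apply: mem_set.
by split => //; apply/ballP.
Qed.

Lemma measurable_oscillation t : (0 < t)%R -> (t <= r0)%R ->
  measurable_fun (S : set (borel X)) (oscillation t : borel X -> \bar R).
Proof.
move=> t0 tr0; apply: emeasurable_funM; last first.
  apply: (@measurable_ball_integral (fun s => `|s| `^ p)%R).
    exact: (measurableT_comp (measurable_powR p) (@normr_measurable R setT)).
  by move=> s; rewrite powR_ge0.
have h : measurable_fun (S : set (borel X)) (fun z : borel X =>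
    \int[nu]_(y in ball z t `&` S) 1%:E).
  exact: (@measurable_ball_integral (cst 1%R)).
(* The inverse of a finite positive number is its power with exponent -1. *)
have mf : measurable_fun (S : set (borel X))
    (fun z : borel X => ((fine (nu (ball z t `&` S))) `^ (-1))%R%:E).
  apply/measurable_EFinP; apply: (measurableT_comp (measurable_powR (-1))).
  apply: (measurableT_comp (fine_measurable measurableT)).
  apply: eq_measurable_fun h => z _; rewrite integral_cst ?mul1e//.
  by apply: measurableI => //; exact: measurable_ballm.
apply: eq_measurable_fun mf => z /set_mem Sz.
have /andP[n0 noo] := nu_fin Sz t0 tr0.
rewrite powR_inv1 ?fine_ge0//.
have nE : nu (ball z t `&` S) = (fine (nu (ball z t `&` S)))%:E.
  by rewrite fineK// ge0_fin_numE.
have f0 : (0 < fine (nu (ball z t `&` S)))%R by rewrite -lte_fin -nE.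
by rewrite [in RHS]nE inver gt_eqF.
Qed.

Variables (alpha D : R) (q : \bar R).
Hypothesis D_gt0 : (0 < D)%R.
Hypothesis nu_double : forall z (r : R), S z -> (0 < r)%R -> (2 * r <= r0)%R ->
  nu (ball z (2 * r) `&` S) <= D%:E * nu (ball z r `&` S).
Hypothesis p_ge1 : (1 <= p)%R.
Hypothesis alpha_gt0 : (0 < alpha)%R.
Hypothesis q_ge1 : 1 <= q.

Local Notation energy := (besov_energy nu S p f).

Let p_gt0 : (0 < p)%R. Proof. exact: lt_le_trans p_ge1. Qed.

Let mball_S z t : measurable (ball z t `&` S : set (borel X)).
Proof. by apply: measurableI => //; exact: measurable_ballm. Qed.

Lemma oscillation_le z (s t : R) : S z -> (0 < s)%R -> (s <= t)%R ->
  (t <= 2 * s)%R -> (2 * s <= r0)%R ->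
  oscillation s z <= D%:E * oscillation t z.
Proof.
move=> Sz s0 st t2s sr0; rewrite /oscillation.
have ss : (s <= r0)%R by lra.
have s2 : (0 < 2 * s)%R by lra.
have /andP[n1 n1y] := nu_fin Sz s0 ss.
have h : nu (ball z t `&` S) <= D%:E * nu (ball z s `&` S).
  apply: le_trans (nu_double Sz s0 sr0); apply: le_measure; rewrite ?inE//.
  by move=> y [zy Sy]; split => //; apply: sub_ballm zy; rewrite mdistxx add0r.
have n2 : 0 < nu (ball z t `&` S).
  apply: lt_le_trans n1 _; apply: le_measure; rewrite ?inE//.
  by move=> y [zy Sy]; split => //; apply: sub_ballm zy; rewrite mdistxx add0r.
have n2y : nu (ball z t `&` S) < +oo.
  apply: le_lt_trans h _; rewrite lte_mul_pinfty// ?lee_fin ?(ltW D_gt0)//.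
set I1 := \int[nu]_(y in _) _; set I2 := \int[nu]_(y in ball z t `&` S) _.
have I12 : I1 <= I2.
  apply: ge0_subset_integral => //.
  - apply/measurable_EFinP; apply: (measurableT_comp (measurable_powR p)).
    apply: (measurableT_comp (@normr_measurable R setT)).
    by apply: measurable_funB => //; apply: measurable_funS f_meas.
  by move=> y [zy Sy]; split => //; apply: sub_ballm zy; rewrite mdistxx add0r.
have I20 : 0 <= I2 by apply: integral_ge0 => y _; rewrite lee_fin powR_ge0.
apply: (@le_trans _ _ ((nu (ball z s `&` S))^-1 * I2)).
  by apply: lee_wpmul2l => //; rewrite inve_ge0.
rewrite muleA; apply: lee_wpmul2r => //.
move: h n1 n1y n2 n2y.
case: (nu (ball z s `&` S)) => [n| |]//; case: (nu (ball z t `&` S)) => [n'| |]//.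
rewrite -EFinM !lte_fin lee_fin => h n0 _ n'0 _.
rewrite !inver !gt_eqF// -EFinM lee_fin.
by rewrite ler_pdivlMr// mulrC ler_pdivrMr.
Qed.

Lemma energy_ge0 t : 0 <= energy t.
Proof. by apply: integral_ge0 => z _; exact: oscillation_ge0. Qed.

Lemma energy_le (s t : R) : (0 < s)%R -> (s <= t)%R -> (t <= 2 * s)%R ->
  (2 * s <= r0)%R -> energy s <= D%:E * energy t.
Proof.
move=> s0 st t2s sr0; rewrite /besov_energy.
rewrite -ge0_integralZl_EFin//; last 3 first.
- by move=> z _; exact: oscillation_ge0.
- by apply: measurable_oscillation; lra.
- exact: ltW.
apply: le_lower_integral => z Sz; first exact: oscillation_ge0.
exact: oscillation_le.
Qed.

(** For q = +oo this is the definition of the seminorm.  For finite q the part of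
    the integral over [s,2s] already bounds the energy at scale s, which is at
    most D times the energy at every scale in that interval. *)
Lemma energy_decay : besov_seminorm nu S alpha p q f < +oo ->
  exists2 B : R, (0 <= B)%R & forall s : R, (0 < s)%R -> (2 * s <= r0)%R ->
    energy s <= (B * s `^ (alpha * p))%:E.
Proof.
case: q q_ge1 => [q'| |]//= q1.
- rewrite lee_fin in q1; have q0 : (0 < q')%R by lra.
  set J := \int[_]_(t in _) _ => Jq.
  have J0 : 0 <= J.
    apply: integral_ge0 => t _; rewrite mule_ge0 ?poweR_ge0// lee_fin invr_ge0.
    exact: powR_ge0.
  have Joo : J < +oo by apply: lty_poweRy Jq; rewrite invr_neq0// gt_eqF.
  have JE : J = (fine J)%:E by rewrite fineK// ge0_fin_numE.
  set j := fine J in JE; have j0 : (0 <= j)%R by rewrite fine_ge0.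
  pose b : R := (alpha * q' + 1)%R.
  have b0 : (0 < b)%R by rewrite addr_gt0// mulr_gt0.
  exists (D * (j * 2 `^ b) `^ (p / q'))%R.
    by rewrite mulr_ge0 ?powR_ge0// ltW.
  move=> s s0 sr0.
  have Di0 : (0 <= D^-1)%R by rewrite invr_ge0 ltW.
  set E := energy s; have E0 : 0 <= E by exact: energy_ge0.
  have key : (D^-1%:E * E) `^ (q' / p) * (((2 * s) `^ b)^-1)%:E * s%:E <= j%:E.
    rewrite -JE.
    have -> : s%:E = (@lebesgue_measure R) `[s, (2 * s)%R]%classic.
      rewrite lebesgue_measure_itv/= lte_fin ifT; last by lra.
      by rewrite -EFinB; congr EFin; lra.
    rewrite -integral_cst//.
    apply: (@le_trans _ _ (\int[@lebesgue_measure R]_(t in `[s, (2 * s)%R]%classic)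
      (energy t `^ (q' / p) * ((t `^ b)^-1)%:E))).
      apply: le_lower_integral => t.
        by rewrite mule_ge0 ?poweR_ge0// lee_fin invr_ge0 powR_ge0.
      rewrite /= in_itv/= => /andP[st t2s].
      apply: lee_pmul.
      - exact: poweR_ge0.
      - by rewrite lee_fin invr_ge0 powR_ge0.
      - apply: gt0_ler_poweR; first by rewrite divr_ge0 ?ltW.
        + by rewrite in_itv/= leey andbT mule_ge0.
        + by rewrite in_itv/= leey andbT energy_ge0.
        by rewrite muleC lee_pdivrMr// muleC; exact: energy_le.
      rewrite lee_fin lef_pV2 ?posrE ?powR_gt0//; [|lra|lra].
      by apply: ge0_ler_powR; rewrite ?nnegrE ?(ltW b0)//; lra.
    rewrite integral_mkcond /J [leRHS]integral_mkcond.
    apply: le_lower_integral => t _.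
      apply: erestrict_ge0 => u _.
      by rewrite mule_ge0 ?poweR_ge0// lee_fin invr_ge0 powR_ge0.
    rewrite !patchE; case: ifPn => [|_].
      rewrite inE/= in_itv/= => /andP[st _].
      by rewrite ifT// inE/= in_itv/= andbT; lra.
    by case: ifP => // _; rewrite mule_ge0 ?poweR_ge0// lee_fin invr_ge0 powR_ge0.
  have step : (D^-1%:E * E) `^ (q' / p) <= (j * 2 `^ b * s `^ (alpha * q'))%:E.
    have s2b : (0 < (2 * s) `^ b)%R by rewrite powR_gt0// mulr_gt0.
    move: key; rewrite -lee_pdivlMr// => key.
    move: key; rewrite -lee_pdivlMr ?invr_gt0// invrK -!EFinM => key.
    apply: (le_trans key); rewrite lee_fin powRM ?(ltW s0)//.
    have -> : (s `^ b = s `^ (alpha * q') * s)%R.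
      rewrite /b powRD; last by rewrite gt_eqF// implybT.
      by rewrite powRr1// ltW.
    rewrite le_eqVlt; apply/orP; left; apply/eqP.
    by field; rewrite gt_eqF.
  have step2 : D^-1%:E * E <= ((j * 2 `^ b) `^ (p / q') * s `^ (alpha * p))%:E.
    have DE0 : 0 <= D^-1%:E * E by rewrite mule_ge0.
    have e0 : ((q' / p) * (p / q') = 1)%R by field; rewrite !gt_eqF.
    rewrite -[leLHS]poweRe1// -[X in _ `^ X <= _]e0 poweRrM.
    apply: (@le_trans _ _ ((j * 2 `^ b * s `^ (alpha * q'))%:E `^ (p / q'))).
      apply: gt0_ler_poweR => //; first by rewrite divr_ge0 ?ltW.
      + by rewrite in_itv/= leey andbT poweR_ge0.
      by rewrite in_itv/= leey andbT lee_fin !mulr_ge0 ?powR_ge0.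
    rewrite poweR_EFin lee_fin powRM ?mulr_ge0 ?powR_ge0// -powRrM.
    have e1 : (alpha * q' * (p / q') = alpha * p)%R by field; rewrite gt_eqF.
    by rewrite e1.
  move: step2; rewrite muleC lee_pdivrMr// -EFinM => /le_trans; apply.
  by rewrite lee_fin le_eqVlt; apply/orP; left; apply/eqP; ring.
- set B := ereal_sup _ => Boo.
  have ub t : (0 < t)%R -> (t `^ alpha)^-1%:E * energy t `^ p^-1 <= B.
    by move=> t0; apply: ereal_sup_ubound; exists t.
  have B0 : 0 <= B.
    by apply: le_trans (ub 1%R ltr01); rewrite mule_ge0 ?poweR_ge0.
  have BE : B = (fine B)%:E by rewrite fineK// ge0_fin_numE.
  have b0 : (0 <= fine B)%R by rewrite fine_ge0.
  exists (fine B `^ p)%R; first exact: powR_ge0.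
  move=> s s0 _; have := ub s s0; rewrite BE muleC lee_pdivrMr ?powR_gt0// -EFinM => h.
  rewrite -[leLHS]poweRe1 ?energy_ge0// -(mulVf (lt0r_neq0 p_gt0)) poweRrM.
  apply: (@le_trans _ _ ((fine B * s `^ alpha)%:E `^ p)).
    apply: gt0_ler_poweR => //; first exact: ltW.
    + by rewrite in_itv/= leey andbT poweR_ge0.
    by rewrite in_itv/= leey andbT lee_fin mulr_ge0 ?powR_ge0.
  by rewrite poweR_EFin lee_fin powRM ?powR_ge0// -powRrM.
Qed.

(** The energies at dyadic radii decay geometrically, hence the oscillations
    at dyadic radii are summable almost everywhere.  This takes the place of
    Lebesgue's differentiation theorem. *)
Lemma oscillation_cvg0 : besov_seminorm nu S alpha p q f < +oo ->
  {ae nu, forall z, S z -> forall e : R, (0 < e)%R ->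
    exists N, forall n, (N <= n)%N -> oscillation (2 ^+ n)^-1 z <= e%:E}.
Proof.
move=> /energy_decay[B B0 decay].
have [n0 hn0] : exists n0, (2 * (2 ^+ n0)^-1 <= r0)%R.
  exists (Num.truncn (2 / r0)).+1; rewrite ler_pdivrMr ?exprn_gt0// mulrC.
  rewrite -ler_pdivrMr//; apply: (le_trans (ltW (truncnS_gt _))).
  by rewrite -natrX ler_nat; apply: ltnW; rewrite ltn_expl.
pose s n : R := (2 ^+ (n0 + n))^-1%R.
have s_gt0 n : (0 < s n)%R by rewrite invr_gt0 exprn_gt0.
have s_le n : (2 * s n <= r0)%R.
  apply: le_trans hn0; rewrite ler_pM2l// lef_pV2 ?posrE ?exprn_gt0//.
  by rewrite ler_eXn2l ?leq_addr// ltr1n.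
have s_le0 n : (s n <= r0)%R by have := s_le n; have := s_gt0 n; lra.
have ap0 : (0 < alpha * p)%R by rewrite mulr_gt0.
pose c : R := (2^-1 `^ (alpha * p))%R.
have c01 : (0 <= c < 1)%R by rewrite /c powR_ge0 powR_half_lt1.
pose A : R := (B * ((2 ^+ n0)^-1) `^ (alpha * p))%R.
have A0 : (0 <= A)%R by rewrite mulr_ge0 ?powR_ge0.
have mosc n : measurable_fun (S : set (borel X)) (oscillation (s n) : borel X -> \bar R).
  exact: measurable_oscillation.
have sum_fin : \int[nu]_(z in S) (\sum_(n <oo) oscillation (s n) z) < +oo.
  rewrite integral_nneseries//; last by move=> n z _; exact: oscillation_ge0.
  apply: (@le_lt_trans _ _ (\sum_(n <oo) (A * c ^+ n)%:E)).
    apply: lee_nneseries => [n _ _|n _].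
      by apply: integral_ge0 => z _; exact: oscillation_ge0.
    apply: (le_trans (decay _ (s_gt0 n) (s_le n))).
    have -> : (c ^+ n = (2^-1 ^+ n) `^ (alpha * p))%R by rewrite powR_exprn ?invr_ge0.
    rewrite lee_fin /A -mulrA ler_wpM2l// /s exprD invfM -[((2 ^+ n)^-1)%R]exprVn.
    by rewrite powRM ?exprn_ge0 ?invr_ge0 ?exprn_ge0.
  by apply: le_lt_trans (nneseries_geometric_le A0 c01) _; rewrite ltry.
have osc0 z : 0 <= \sum_(n <oo) oscillation (s n) z.
  by apply: nneseries_ge0 => n _ _; exact: oscillation_ge0.
have int_sum : nu.-integrable (S : set (borel X))
    (fun z : borel X => \sum_(n <oo) oscillation (s n) z).
  apply/integrableP; split.
    apply: (@ge0_emeasurable_sum _ (borel X) R S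
      (fun n (z : borel X) => oscillation (s n) z) xpredT) => //.
    by move=> n z _ _; exact: oscillation_ge0.
  rewrite (eq_integral (fun z : borel X => \sum_(n <oo) oscillation (s n) z))//.
  by move=> z _; rewrite gee0_abs.
have := integrable_ae mS int_sum; apply: filterS => z + Sz e e0.
move=> /(_ Sz); rewrite ge0_fin_numE// => sz.
have := nneseries_tail_cvg sz (fun n _ => oscillation_ge0 _ _).
move=> /fine_cvgP[fin /cvgrPdist_le/(_ e e0)].
move=> /(filterI fin)[N _ HN].
exists (n0 + N)%N => n Nn.
have Nn' : (N <= n - n0)%N by rewrite leq_subRL// (leq_trans _ Nn)// leq_addr.
have [/= finN] := HN _ Nn'.
rewrite sub0r normrN => hN.
have -> : ((2 ^+ n)^-1 = s (n - n0)%N)%R.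
  by rewrite /s subnKC// (leq_trans _ Nn)// leq_addr.
apply: (@le_trans _ _ (\sum_((n - n0)%N <= k <oo) oscillation (s k) z)).
  apply: le_trans (nneseries_lim_ge (n - n0).+1 _); last first.
    by move=> k _ _; exact: oscillation_ge0.
  by rewrite big_nat1.
by rewrite -(fineK finN) lee_fin; apply: le_trans hN; exact: ler_norm.
Qed.

End Oscillation.

(** * Averages over shadows and the trace at points of small oscillation *)

Section CodimensionRegular.
Context {R : realType} {X : completeMetricType R}.
Variables (Omega : set X) (mu nu : {measure set (borel X) -> \bar R}).
Variables (Cmu : R).
Hypotheses (Omega_open : open Omega) (Omega_dense : dense Omega).
Hypotheses (mu_ext0 : mu (~` Omega) = 0%E) (mu_doubling : doubling mu Omega Cmu).

Local Notation S := (bdry Omega).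

Lemma mu_setIdomain (A : set (borel X)) : measurable A -> mu (A `&` Omega) = mu A.
Proof.
move=> mA; have mO : measurable (Omega : set (borel X)) by exact: measurable_open.
rewrite [RHS](measureDI mu mA mO) [X in (X + _)%E](_ : _ = 0%E) ?add0e//.
apply: subset_measure0 mu_ext0; [exact: measurableD|exact: measurableC|].
by move=> x [].
Qed.

Lemma mu_ball_gt0 (x : X) (r : R) : 0 < r -> (0 < mu (ball x r))%E.
Proof.
move=> r0; have r2 : 0 < r / 2 by lra.
have r4 : 0 < r / 4 by lra.
have [y Oy xy] := dense_ball x Omega_dense r2.
have [+ _ _] := mu_doubling.2 y (r / 4) Oy r4.
rewrite mu_setIdomain; last exact: measurable_ballm.
move=> /lt_le_trans; apply; apply: le_measure; rewrite ?inE.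
- exact: measurable_ballm.
- exact: measurable_ballm.
- by apply: sub_ballm; lra.
Qed.

Lemma mu_ball_lty (x : X) (r : R) : (mu (ball x r) < +oo)%E.
Proof.
have [r0|r0] := leP r 0.
  rewrite (_ : ball x r = set0) ?measure0//.
  by apply/seteqP; split => // y /ballP; have := mdist_ge0 x y; lra.
have [y Oy xy] := dense_ball x Omega_dense r0.
have r2 : 0 < 2 * r by lra.
have [_ _] := mu_doubling.2 y (2 * r) Oy r2.
rewrite mu_setIdomain; last exact: measurable_ballm.
apply: le_lt_trans; apply: (@le_trans _ _ (mu (ball y (2 * r)))).
  apply: le_measure; rewrite ?inE.
  - exact: measurable_ballm.
  - exact: measurable_ballm.
  - by apply: sub_ballm; rewrite metric_sym; lra.
have [C1 _] := mu_doubling.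
by apply: lee_pemull; rewrite ?lee_fin.
Qed.

Definition mball (x : X) (r : R) : R := fine (mu (ball x r)).

Lemma mballE (x : X) (r : R) : mu (ball x r) = (mball x r)%:E.
Proof. by rewrite fineK// ge0_fin_numE// mu_ball_lty. Qed.

Lemma mball_gt0 (x : X) (r : R) : 0 < r -> 0 < mball x r.
Proof. by move=> r0; rewrite -lte_fin -mballE mu_ball_gt0. Qed.

Lemma mball_le (x y : X) (r s : R) : mdist x y + r <= s -> mball y r <= mball x s.
Proof.
move=> h; rewrite -lee_fin -!mballE; apply: le_measure; rewrite ?inE.
- exact: measurable_ballm.
- exact: measurable_ballm.
- exact: sub_ballm.
Qed.

(** Doubling holds at the points of Omega; a ball with an arbitrary centre is
    compared to balls centred at a nearby point of Omega, where the radius has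
    to be doubled three times, from r/2 to 4r. *)
Lemma mball_double (x : X) (r : R) : 0 < r ->
  mball x (2 * r) <= Cmu ^+ 3 * mball x r.
Proof.
move=> r0; have r2 : 0 < r / 2 by lra.
have [y Oy xy] := dense_ball x Omega_dense r2.
have C0 : 0 <= Cmu by have [] := mu_doubling; lra.
have dbl s : 0 < s -> mball y (2 * s) <= Cmu * mball y s.
  move=> s0; have [_ + _] := mu_doubling.2 y s Oy s0.
  by rewrite !mu_setIdomain ?mballE -?EFinM ?lee_fin//; exact: measurable_ballm.
apply: (@le_trans _ _ (mball y (2 * (2 * (2 * (r / 2)))))).
  by apply: mball_le; rewrite metric_sym; lra.
apply: (@le_trans _ _ (Cmu ^+ 3 * mball y (r / 2))).
  have r22 : 0 < 2 * (r / 2) by lra.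
  have r222 : 0 < 2 * (2 * (r / 2)) by lra.
  apply: le_trans (dbl _ r222) _; rewrite exprS -mulrA; apply: ler_wpM2l => //.
  apply: le_trans (dbl _ r22) _; rewrite exprS -mulrA; apply: ler_wpM2l => //.
  by rewrite expr1; exact: dbl.
apply: ler_wpM2l; first by rewrite exprn_ge0.
by apply: mball_le; lra.
Qed.

Lemma mball_double_iter n (x : X) (r : R) : 0 < r ->
  mball x (2 ^+ n * r) <= (Cmu ^+ 3) ^+ n * mball x r.
Proof.
move=> r0; elim: n => [|n IHn]; first by rewrite !expr0 !mul1r.
have C0 : 0 <= Cmu by have [] := mu_doubling; lra.
rewrite exprS -mulrA; apply: le_trans (mball_double _ _) _.
  by rewrite mulr_gt0// exprn_gt0.
by rewrite [_ ^+ n.+1]exprS -mulrA; apply: ler_wpM2l => //; rewrite exprn_ge0.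
Qed.

Variables (Cnu theta r0 : R).
Hypotheses (theta_gt0 : 0 < theta) (Cnu_ge1 : 1 <= Cnu).
Hypothesis nu_regular : forall z (r : R), S z -> 0 < r -> r <= r0 ->
  ((Cnu^-1 / r `^ theta)%:E * mu (ball z r `&` Omega)
     <= nu (ball z r `&` S) /\
   nu (ball z r `&` S)
     <= (Cnu / r `^ theta)%:E * mu (ball z r `&` Omega))%E.

Definition nball (x : X) (r : R) : R := fine (nu (ball x r `&` S)).

Let muOE x r : mu (ball x r `&` Omega) = (mball x r)%:E.
Proof. by rewrite mu_setIdomain ?mballE//; exact: measurable_ballm. Qed.

Lemma nballE z r : S z -> 0 < r -> r <= r0 ->
  nu (ball z r `&` S) = (nball z r)%:E.
Proof.
move=> Sz r_gt0 rr0; rewrite fineK// ge0_fin_numE//.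
have [_ /le_lt_trans] := nu_regular Sz r_gt0 rr0; apply.
by rewrite muOE -EFinM ltry.
Qed.

Lemma nball_bounds z r : S z -> 0 < r -> r <= r0 ->
  Cnu^-1 / r `^ theta * mball z r <= nball z r <= Cnu / r `^ theta * mball z r.
Proof.
move=> Sz r_gt0 rr0; have [] := nu_regular Sz r_gt0 rr0.
by rewrite muOE nballE// -!EFinM !lee_fin => -> ->.
Qed.

Lemma nball_gt0 z r : S z -> 0 < r -> r <= r0 -> 0 < nball z r.
Proof.
move=> Sz r_gt0 rr0; have /andP[+ _] := nball_bounds Sz r_gt0 rr0.
apply: lt_le_trans; rewrite mulr_gt0 ?mball_gt0// divr_gt0 ?powR_gt0//.
by rewrite invr_gt0; apply: lt_le_trans Cnu_ge1.
Qed.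

(** Regularity compares nu to mu on both balls, and mu is doubling. *)
Lemma nball_double z r : S z -> 0 < r -> 2 * r <= r0 ->
  nball z (2 * r) <= Cnu ^+ 2 * Cmu ^+ 3 * nball z r.
Proof.
move=> Sz r_gt0 rr0; have r2 : 0 < 2 * r by lra.
have rr : r <= r0 by lra.
have Cn0 : 0 < Cnu by apply: lt_le_trans Cnu_ge1.
have C0 : 0 <= Cmu by have [] := mu_doubling; lra.
have rt0 : 0 < r `^ theta by exact: powR_gt0.
have /andP[_ h1] := nball_bounds Sz r2 rr0.
have /andP[h2 _] := nball_bounds Sz r_gt0 rr.
have h3 := mball_double z r_gt0.
have h4 : mball z r <= Cnu * r `^ theta * nball z r.
  by rewrite -ler_pdivrMl ?mulr_gt0// invfM.
apply: (le_trans h1).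
apply: (@le_trans _ _ (Cnu / r `^ theta * mball z (2 * r))).
  rewrite ler_wpM2r ?fine_ge0// ler_wpM2l ?(ltW Cn0)// lef_pV2 ?posrE ?powR_gt0//.
  by apply: ge0_ler_powR; rewrite ?nnegrE ?(ltW theta_gt0) ?(ltW r_gt0) ?(ltW r2)//; lra.
apply: (@le_trans _ _
    (Cnu / r `^ theta * (Cmu ^+ 3 * (Cnu * r `^ theta * nball z r)))).
  rewrite ler_wpM2l ?divr_ge0 ?(ltW Cn0) ?(ltW rt0)//.
  by apply: (le_trans h3); rewrite ler_wpM2l// exprn_ge0.
rewrite le_eqVlt; apply/orP; left; apply/eqP.
by field; rewrite gt_eqF.
Qed.

Variables (C : R) (W : whitney Omega Cmu C).

Local Notation wball2 := (wball2 W).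

(** The density on the shadow U_k that results from spreading the mean over
    U_k uniformly on the ball 2B_k and integrating for mu. *)
Definition wweight (k : int * nat) : R :=
  fine (mu (wball2 k)) / nball (wnear W k) (wradius W k).

Lemma mu_wball2_fin k : mu (wball2 k) \is a fin_num.
Proof.
rewrite ge0_fin_numE//.
apply: le_lt_trans (mu_ball_lty (wcenter W k) (2 * wradius W k)).
apply: le_measure; rewrite ?inE; [exact: measurable_wball2|exact: measurable_ballm|].
by move=> x [].
Qed.

Lemma wweight_ge0 k : 0 <= wweight k.
Proof. by rewrite divr_ge0 ?fine_ge0. Qed.

Lemma wweight_out k : ~ windex W k -> wweight k = 0.
Proof.
move=> Wk; rewrite /wweight (_ : wball2 k = set0) ?measure0 ?mul0r//.
by apply/seteqP; split => // x [].
Qed.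

(** Up to the factor 2^(i theta), codimension regularity and doubling bound the
    weight of one ball by the share that it takes of a ball of comparable
    radius around the point y of its shadow; the balls of one scale have
    bounded overlap, so these shares sum up to at most a constant. *)
Lemma wweight_sum (i : int) (y : X) : S y -> 2 ^ i <= r0 ->
  (\sum_(j <oo) (wweight (i, j) * \1_(wshadow W (i, j)) y)%:E
    <= (2 * Cmu ^+ 5 * Cnu * (Cmu ^+ 3) ^+ 5 * (2 ^ i) `^ theta)%:E)%E.
Proof.
move=> Sy ir0; set s : R := 2 ^ i in ir0 *.
(* A point of 2B_k is within 11 r_k <= 12 s of y, and B(y,12s) lies in the ball
   of radius 32 r_k around the boundary point nearest to the centre. *)
have s0 : 0 < s by exact: exprz2_gt0.
have s12 : 0 < 12 * s by lra.
have V0 := mball_gt0 y s12; set V := mball y (12 * s) in V0.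
have Cn0 : 0 < Cnu by apply: lt_le_trans Cnu_ge1.
have C0 : 0 < Cmu by have [] := mu_doubling; lra.
pose L := Cnu * (Cmu ^+ 3) ^+ 5 * s `^ theta / V.
have L0 : 0 <= L.
  by rewrite divr_ge0 ?mulr_ge0 ?powR_ge0 ?exprn_ge0 ?(ltW Cn0) ?(ltW C0) ?(ltW V0).
have term j : wweight (i, j) * \1_(wshadow W (i, j)) y
    <= L * fine (mu (wball2 (i, j) `&` ball y (12 * s))).
  set k := (i, j).
  have R0 : 0 <= L * fine (mu (wball2 k `&` ball y (12 * s))).
    by rewrite mulr_ge0 ?fine_ge0.
  have [Wk|Wk] := pselect (windex W k); last by rewrite wweight_out// mul0r.
  have [Uy|Uy] := pselect (wshadow W k y); last by rewrite indicE memNset ?mulr0.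
  rewrite indicE mem_set// mulr1.
  have [/ballP qy _] := Uy.
  have r_gt0 := wradius_gt0 Wk; have rs := wradius_le Wk; have sr := wradius_gt Wk.
  rewrite -/s /= in rs sr; set r := wradius W k in qy r_gt0 rs sr.
  have r2 : 0 < 2 ^+ 5 * r by rewrite mulr_gt0// exprn_gt0.
  have Sq := wnear_in Wk.
  have rr0 : r <= r0 by lra.
  rewrite (_ : wball2 k `&` ball y (12 * s) = wball2 k); last first.
    apply/setIidl => x [_ /ballP px]; apply/ballP.
    have := metric_triangle y (wnear W k) x.
    have := metric_triangle (wnear W k) (wcenter W k) x.
    rewrite (metric_sym (wnear W k) (wcenter W k)) wnearE//.
    by rewrite (metric_sym y (wnear W k)) -/r in px *; lra.
  rewrite /wweight mulrC ler_wpM2r ?fine_ge0// -/r.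
  have h1 : V <= (Cmu ^+ 3) ^+ 5 * mball (wnear W k) r.
    apply: le_trans (mball_double_iter 5 (wnear W k) r_gt0).
    by apply: mball_le; lra.
  have /andP[h2 _] := nball_bounds Sq r_gt0 rr0.
  have h3 : r `^ theta <= s `^ theta.
    by apply: ge0_ler_powR; rewrite ?nnegrE ?(ltW theta_gt0) ?(ltW r_gt0) ?(ltW s0).
  have n0 := nball_gt0 Sq r_gt0 rr0.
  have rt0 : 0 < r `^ theta by exact: powR_gt0.
  have h4 : mball (wnear W k) r <= Cnu * s `^ theta * nball (wnear W k) r.
    apply: (@le_trans _ _ (Cnu * r `^ theta * nball (wnear W k) r)).
      by rewrite -ler_pdivrMl ?mulr_gt0// invfM.
    by rewrite ler_wpM2r ?(ltW n0)// ler_wpM2l// ltW.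
  rewrite -[X in X <= _]mul1r /L ler_pdivrMr// mulrAC ler_pdivlMr// mul1r.
  apply: (le_trans h1); apply: (@le_trans _ _
      ((Cmu ^+ 3) ^+ 5 * (Cnu * s `^ theta * nball (wnear W k) r))).
    by rewrite ler_wpM2l// !exprn_ge0// ltW.
  by rewrite le_eqVlt; apply/orP; left; apply/eqP; ring.
apply: (@le_trans _ _
    (\sum_(j <oo) (L%:E * mu (wball2 (i, j) `&` ball y (12 * s))))%E).
  apply: lee_nneseries => [j _ _|j _].
    by rewrite lee_fin mulr_ge0// wweight_ge0.
  apply: (@le_trans _ _ (L * fine (mu (wball2 (i, j) `&` ball y (12 * s))))%:E).
    by rewrite lee_fin.
  rewrite EFinM fineK// ge0_fin_numE//.
  apply: le_lt_trans (_ : mu (wball2 (i, j)) < _)%E; last first.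
    by rewrite -ge0_fin_numE// mu_wball2_fin.
  apply: le_measure; rewrite ?inE; last by move=> x [].
    by apply: measurableI; [exact: measurable_wball2|exact: measurable_ballm].
  exact: measurable_wball2.
rewrite nneseriesZl//.
rewrite (eq_eseriesr (g := fun j =>
    \int[mu]_(x in ball y (12 * s)) (\1_(wball2 (i, j)) x)%:E)%E); last first.
  move=> j _; rewrite integral_indic//.
    exact: measurable_ballm.
  exact: measurable_wball2.
rewrite -integral_nneseries; last 3 first.
- exact: measurable_ballm.
- move=> n; apply/measurable_EFinP; apply: measurable_indic; exact: measurable_wball2.
- by move=> n x _; rewrite lee_fin.
apply: (@le_trans _ _ (L%:E * ((2 * Cmu ^+ 5)%:E * mu (ball y (12 * s)))))%E.
  apply: lee_wpmul2l; first by rewrite lee_fin.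
  rewrite -integral_cst; last exact: measurable_ballm.
  apply: le_lower_integral => x _; last exact: wball2_scale_overlap.
  by apply: nneseries_ge0 => n _ _; rewrite lee_fin.
rewrite mballE -!EFinM lee_fin /L -/V le_eqVlt; apply/orP; left; apply/eqP.
by field; rewrite gt_eqF.
Qed.

Section WhitneyMajorant.
Local Open Scope ereal_scope.

Definition scale_majorant (h : X -> R) (i : int) (x : X) : \bar R :=
  \sum_(j <oo) (\1_(wball2 (i, j)) x)%:E * shadow_average nu W h (i, j).

(** The sum over the balls of all scales up to 2^-n. *)
Definition whitney_majorant (h : X -> R) (n : nat) (x : X) : \bar R :=
  \sum_(m <oo) scale_majorant h (- (n + m)%:Z) x.

Definition average_const : R := (2 * Cmu ^+ 5 * Cnu * (Cmu ^+ 3) ^+ 5)%R.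

Let Cmu_ge1 : (1 <= Cmu)%R. Proof. by have [] := mu_doubling. Qed.

Lemma average_const_gt0 : (0 < average_const)%R.
Proof.
have Cn0 : (0 < Cnu)%R by apply: lt_le_trans Cnu_ge1.
have C0 : (0 < Cmu)%R by apply: lt_le_trans Cmu_ge1.
by rewrite /average_const !mulr_gt0 ?exprn_gt0.
Qed.

Section Bound.
Variable h : X -> R.
Hypothesis h_meas : measurable_fun (S : set (borel X)) (h : borel X -> R).
Hypothesis h_ge0 : forall y, S y -> (0 <= h y)%R.

Let mS : measurable (S : set (borel X)). Proof. exact: measurable_bdry. Qed.

Lemma shadow_average_ge0 k : 0 <= shadow_average nu W h k.
Proof.
rewrite mule_ge0 ?inve_ge0//; apply: integral_ge0 => y [_ Sy].
by rewrite lee_fin h_ge0.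
Qed.

Lemma scale_majorant_ge0 i x : 0 <= scale_majorant h i x.
Proof.
by apply: nneseries_ge0 => j _ _; rewrite mule_ge0 ?lee_fin ?shadow_average_ge0.
Qed.

Lemma whitney_majorant_ge0 n x : 0 <= whitney_majorant h n x.
Proof. by apply: nneseries_ge0 => m _ _; exact: scale_majorant_ge0. Qed.

Let measurable_term i j : measurable_fun (setT : set (borel X))
  (fun x : borel X => (\1_(wball2 (i, j)) x)%:E * shadow_average nu W h (i, j)).
Proof.
apply: emeasurable_funM; last exact: measurable_cst.
by apply/measurable_EFinP; apply: measurable_indic; exact: measurable_wball2.
Qed.

Lemma measurable_scale_majorant i :
  measurable_fun (setT : set (borel X)) (scale_majorant h i : borel X -> \bar R).
Proof.
apply: (@ge0_emeasurable_sum _ (borel X) R setT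
  (fun j x => (\1_(wball2 (i, j)) x)%:E * shadow_average nu W h (i, j)) xpredT).
  by move=> j x _ _; rewrite mule_ge0 ?lee_fin ?shadow_average_ge0.
by move=> j _; exact: measurable_term.
Qed.

Lemma measurable_whitney_majorant n :
  measurable_fun (setT : set (borel X)) (whitney_majorant h n : borel X -> \bar R).
Proof.
apply: (@ge0_emeasurable_sum _ (borel X) R setT
  (fun m x => scale_majorant h (- (n + m)%:Z) x) xpredT).
  by move=> j x _ _; exact: scale_majorant_ge0.
by move=> j _; exact: measurable_scale_majorant.
Qed.

Let hE_meas : measurable_fun (S : set (borel X)) (fun y : borel X => (h y)%:E).
Proof. exact/measurable_EFinP. Qed.

Lemma mu_shadow_average i j : (2 ^ i <= r0)%R ->
  mu (wball2 (i, j)) * shadow_average nu W h (i, j) =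
  \int[nu]_(y in S) ((h y)%:E * (wweight (i, j) * \1_(wshadow W (i, j)) y)%:E).
Proof.
move=> ir0; set k := (i, j).
have [Wk|Wk] := pselect (windex W k); last first.
  rewrite (_ : wball2 k = set0); last by apply/seteqP; split => // x [].
  rewrite measure0 mul0e integral0_eq// => y _.
  by rewrite wweight_out// mul0r mule0.
have Sq := wnear_in Wk; have r_gt0 := wradius_gt0 Wk.
have rr0 : (wradius W k <= r0)%R by apply: le_trans ir0; exact: (wradius_le Wk).
have n0 := nball_gt0 Sq r_gt0 rr0.
rewrite /shadow_average muleA {1}/wshadow nballE// inver gt_eqF//.
rewrite -(fineK (mu_wball2_fin k)) -EFinM -/(wweight k).
rewrite /wshadow integral_mkcondl -ge0_integralZl_EFin//; last 3 first.
- by move=> y Sy; rewrite patchE; case: ifP => // _; rewrite lee_fin h_ge0.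
- apply/measurable_restrict => //; first exact: measurable_ballm.
  by apply: measurable_funS hE_meas => //; exact: subIsetl.
- exact: wweight_ge0.
apply: eq_integral => y /set_mem Sy.
rewrite patchE indicE in_setI (mem_set Sy) andbT.
by case: ifP => _; rewrite ?mulr1 ?mulr0 ?mule0// muleC.
Qed.

(** On the boundary side the sum over j becomes the total weight of the shadows
    of scale 2^i that contain y. *)
Lemma integral_scale_majorant i : (2 ^ i <= r0)%R ->
  \int[mu]_x scale_majorant h i x <=
  (average_const * (2 ^ i) `^ theta)%:E * \int[nu]_(y in S) (h y)%:E.
Proof.
move=> ir0; rewrite integral_nneseries//; last first.
  by move=> j x _; rewrite mule_ge0 ?lee_fin ?shadow_average_ge0.
rewrite (eq_eseriesr (g := fun j => \int[nu]_(y in S)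
   ((h y)%:E * (wweight (i, j) * \1_(wshadow W (i, j)) y)%:E))); last first.
  move=> j _; rewrite -mu_shadow_average// ge0_integralZr//; last 2 first.
  - by apply/measurable_EFinP; apply: measurable_indic; exact: measurable_wball2.
  - exact: shadow_average_ge0.
  by rewrite integral_indic// ?setIT//; exact: measurable_wball2.
have w0 j y : 0 <= (wweight (i, j) * \1_(wshadow W (i, j)) y)%:E.
  by rewrite lee_fin mulr_ge0// wweight_ge0.
rewrite -integral_nneseries//; last 2 first.
- move=> j; apply: emeasurable_funM => //; apply/measurable_EFinP.
  apply: measurable_funM; first exact: measurable_cst.
  by apply: measurable_indic; exact: measurable_wshadow.
- by move=> j y Sy; rewrite mule_ge0// lee_fin h_ge0.
rewrite -ge0_integralZl_EFin//; last first.
  by rewrite mulr_ge0 ?powR_ge0// ltW// average_const_gt0.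
apply: le_lower_integral => y Sy.
  by apply: nneseries_ge0 => j _ _; rewrite mule_ge0// lee_fin h_ge0.
rewrite nneseriesZl// muleC lee_wpmul2r ?lee_fin ?h_ge0//.
by have := wweight_sum Sy ir0.
Qed.

(** The scales form a geometric series of ratio 2^-theta. *)
Lemma integral_whitney_majorant n : ((2 ^+ n)^-1 <= r0)%R ->
  \int[mu]_x whitney_majorant h n x <=
  (average_const / (1 - 2^-1 `^ theta) * ((2 ^+ n)^-1) `^ theta)%:E
    * \int[nu]_(y in S) (h y)%:E.
Proof.
move=> nr0; rewrite integral_nneseries//; last 2 first.
- by move=> m; exact: measurable_scale_majorant.
- by move=> m x _; exact: scale_majorant_ge0.
set I := \int[nu]_(y in S) _.
have I0 : 0 <= I by apply: integral_ge0 => y Sy; rewrite lee_fin h_ge0.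
pose z : R := (2^-1 `^ theta)%R.
have z1 : (0 <= z < 1)%R by rewrite /z powR_ge0 powR_half_lt1.
pose a : R := (average_const * ((2 ^+ n)^-1) `^ theta)%R.
have a0 : (0 < a)%R by rewrite mulr_gt0 ?average_const_gt0// powR_gt0.
have z1' : (0 < 1 - z)%R by have /andP[] := z1; lra.
have aE : (average_const / (1 - z) * ((2 ^+ n)^-1) `^ theta = a / (1 - z))%R.
  by rewrite /a mulrAC.
rewrite aE.
have scaleE m : (2 ^ (- (n + m)%:Z) = (2 ^+ n)^-1 * 2^-1 ^+ m :> R)%R.
  by rewrite -exprz_inv -exprnP exprD exprVn.
apply: (@le_trans _ _ (\sum_(m <oo) ((a * z ^+ m)%:E * I))).
  apply: lee_nneseries => [m _ _|m _].
    by apply: integral_ge0 => x _; exact: scale_majorant_ge0.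
  rewrite /a /z -mulrA [X in (_ * X)%R](_ : _ = (2 ^ (- (n + m)%:Z)) `^ theta)%R.
    apply: integral_scale_majorant; rewrite scaleE; apply: le_trans nr0.
    by rewrite ler_piMr ?invr_ge0 ?exprn_ge0// exprn_ile1 ?invr_ge0 ?invf_le1 ?ler1n.
  by rewrite scaleE powRM ?invr_ge0 ?exprn_ge0// powR_exprn ?invr_ge0.
case: I I0 => [I| |//] I0; last first.
  by rewrite gt0_muley ?leey// lte_fin divr_gt0.
under eq_eseriesr do rewrite muleC.
rewrite nneseriesZl; last first.
  by move=> m _; rewrite lee_fin mulr_ge0 ?(ltW a0)// exprn_ge0//; case/andP: z1.
by rewrite muleC lee_wpmul2r//; apply: nneseries_geometric_le => //; exact: ltW.
Qed.

End Bound.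
End WhitneyMajorant.

Variables (p : R) (Phi f : X -> R).
Hypotheses (r0_gt0 : 0 < r0) (p_ge1 : 1 <= p) (Phi_cutoff : cutoff Omega Phi).
Hypothesis f_meas : measurable_fun (S : set (borel X)) (f : borel X -> R).

(** Truncation to the ball turns the global bound on the integral of the majorant
    into a bound by the oscillation at z. *)
Definition truncated_deviation (z : X) (t : R) (y : X) : R :=
  `|f y - f z| `^ p * \1_(ball z t) y.

Let h_ge0 z t y : S y -> 0 <= truncated_deviation z t y.
Proof. by move=> _; rewrite mulr_ge0// powR_ge0. Qed.

Let mS : measurable (S : set (borel X)). Proof. exact: measurable_bdry. Qed.

Let h_meas z t : measurable_fun (S : set (borel X))
  (truncated_deviation z t : borel X -> R).
Proof.
apply: measurable_funM; last by apply: measurable_indic; exact: measurable_ballm.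
apply: (measurableT_comp (measurable_powR p)).
apply: (measurableT_comp (@normr_measurable R setT)).
exact: measurable_funB.
Qed.

(** A single average dominates the deviation at x, and its term occurs in the
    majorant: its ball is of scale at most 2^-n, and its shadow lies in the
    ball B(z,2^-n), where the truncation has no effect. *)
Lemma deviation_le_majorant x z r n : Omega x -> S z -> mdist z x < r ->
  r <= 1 -> r <= r0 -> 4 * r <= (2 ^+ n)^-1 ->
  ((`|whitney_ext W nu Phi f x - f z| `^ p)%:E
    <= whitney_majorant (truncated_deviation z (2 ^+ n)^-1) n x)%E.
Proof.
move=> Ox Sz zx r1 rr0 rn; set h := truncated_deviation _ _.
have p0 : 0 < p by apply: lt_le_trans p_ge1.
have xz : mdist x z <= 1 by rewrite metric_sym; lra.
rewrite (whitney_ext_near nu W Phi_cutoff f Ox Sz xz).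
have [k kx dom] := whitney_ext0_dominated nu W f (f z) Ox.
have Wk : windex W k by case: kx.
have rk := wball2_small kx Sz zx; have rk0 := wradius_gt0 Wk.
have rkr0 : wradius W k <= r0 by lra.
have Sq := wnear_in Wk.
have nuU : (0 < nu (wshadow W k) < +oo)%E.
  by rewrite /wshadow nballE// lte_fin nball_gt0// ltry.
apply: (@le_trans _ _ (shadow_average nu W h k)).
  apply: (@le_trans _ _ (`|waverage W nu f k - f z| `^ p)%:E).
    by rewrite lee_fin; apply: ge0_ler_powR; rewrite ?nnegrE ?(ltW p0).
  apply: le_trans (waverage_dev_le Omega_open (f z) Wk p_ge1 nuU f_meas) _.
  rewrite /shadow_average le_eqVlt; apply/orP; left; apply/eqP.
  congr (_ * _)%E; apply: eq_integral => y /set_mem Uy.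
  rewrite /h /truncated_deviation indicE mem_set ?mulr1//.
  have /ballP := wshadow_sub kx Sz zx Uy; move=> zy; apply/ballP; lra.
have [m km] : exists m, k.1 = - (n + m)%:Z by apply: (wradius_level Wk); lra.
have kE : k = (- (n + m)%:Z, k.2) by rewrite -km; case: (k).
apply: (@le_trans _ _ (scale_majorant h (- (n + m)%:Z) x)).
  pose i : int := - (n + m)%:Z.
  pose u j := ((\1_(wball2 (i, j)) x)%:E * shadow_average nu W h (i, j))%E.
  have u0 j : (0 <= u j)%E.
    by rewrite mule_ge0 ?lee_fin//; apply: shadow_average_ge0; exact: h_ge0.
  apply: le_trans (nneseries_term_le k.2 u0).
  by rewrite /u -kE indicE mem_set// mul1e.
have v0 i : (0 <= scale_majorant h (- (n + i)%:Z)%R x)%E.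
  by apply: scale_majorant_ge0; exact: h_ge0.
exact: (nneseries_term_le m v0).
Qed.

Definition trace_const : R :=
  average_const / (1 - 2^-1 `^ theta) * Cnu * (Cmu ^+ 3) ^+ 3.

Lemma trace_const_gt0 : 0 < trace_const.
Proof.
have Cn0 : 0 < Cnu by apply: lt_le_trans Cnu_ge1.
have C0 : 0 < Cmu by have [] := mu_doubling; lra.
have A0 := average_const_gt0.
have := powR_half_lt1 theta_gt0; rewrite /trace_const => h.
by rewrite !mulr_gt0 ?invr_gt0 ?subr_gt0 ?exprn_gt0.
Qed.

(** Regularity at scale 2^-n cancels the factor 2^(-n theta) of the majorant, and
    B(z,2^-n) is at most three doublings larger than B(z,r). *)
Lemma integral_majorant_le z r n (e : R) : S z -> 0 < r -> 0 < e ->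
  (2 ^+ n)^-1 <= r0 -> (2 ^+ n)^-1 <= 8 * r ->
  (oscillation S nu p f (2 ^+ n)^-1 z <= e%:E)%E ->
  (\int[mu]_x whitney_majorant (truncated_deviation z (2 ^+ n)^-1) n x
    <= (trace_const * e)%:E * mu (ball z r))%E.
Proof.
move=> Sz r_gt0 e0 nr0 n8; set t := (2 ^+ n)^-1 in nr0 n8 *.
have t0 : 0 < t by rewrite invr_gt0 exprn_gt0.
have Cn0 : 0 < Cnu by apply: lt_le_trans Cnu_ge1.
have C0 : 0 < Cmu by have [] := mu_doubling; lra.
have A0 := average_const_gt0.
rewrite /oscillation average_le; last by rewrite nballE// lte_fin nball_gt0// ltry.
rewrite nballE// => hI.
apply: (le_trans (integral_whitney_majorant (h_meas z t) (@h_ge0 z t) nr0)).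
rewrite -/t; set K := (_ / (1 - _)).
have K0 : 0 < K by rewrite divr_gt0// subr_gt0 powR_half_lt1.
have tt0 : 0 < t `^ theta by exact: powR_gt0.
have -> : (\int[nu]_(y in S) (truncated_deviation z t y)%:E
    = \int[nu]_(y in ball z t `&` S) (`|f y - f z| `^ p)%:E)%E.
  rewrite integral_mkcondl; apply: eq_integral => y _.
  rewrite patchE /truncated_deviation indicE.
  by case: ifP => _; rewrite ?mulr1 ?mulr0.
apply: (@le_trans _ _ ((K * t `^ theta)%:E * (e%:E * (nball z t)%:E))%E).
  by apply: lee_wpmul2l => //; rewrite lee_fin mulr_ge0 ?ltW.
rewrite mballE -!EFinM lee_fin.
have /andP[_ hn] := nball_bounds Sz t0 nr0.
have hm : mball z t <= (Cmu ^+ 3) ^+ 3 * mball z r.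
  apply: le_trans (mball_double_iter 3 z r_gt0); apply: mball_le.
  rewrite mdistxx add0r; apply: (le_trans n8).
  by rewrite ler_pM2r// -natrX.
apply: (@le_trans _ _ (K * t `^ theta *
    (e * (Cnu / t `^ theta * ((Cmu ^+ 3) ^+ 3 * mball z r))))).
  rewrite (ler_pM2l (mulr_gt0 K0 tt0)) ler_pM2l//; apply: (le_trans hn).
  by rewrite ler_pM2l// divr_gt0.
rewrite /trace_const -/K le_eqVlt; apply/orP; left; apply/eqP.
by field; rewrite gt_eqF.
Qed.

Lemma trace_whitney_ext z : S z ->
  (forall e : R, 0 < e -> exists N, forall n, (N <= n)%N ->
    (oscillation S nu p f (2 ^+ n)^-1 z <= e%:E)%E) ->
  trace mu p (whitney_ext W nu Phi f) z = (f z)%:E.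
Proof.
move=> Sz osc0; apply: (trace_eq Omega_open mu_ext0 p_ge1).
  by move=> r r_gt0; rewrite mu_ball_gt0//= mu_ball_lty.
move=> e e0; have K0 := trace_const_gt0.
have eK0 : 0 < e / trace_const by rewrite divr_gt0.
have [N HN] := osc0 _ eK0.
near=> r.
have r_gt0 : 0 < r by near: r; exact: nbhs_right_gt.
have r8 : 8 * r <= 1.
  have : r <= 8^-1 by near: r; apply: nbhs_right_le; rewrite invr_gt0.
  lra.
have r8r0 : 8 * r <= r0.
  have : r <= r0 / 8 by near: r; apply: nbhs_right_le; rewrite divr_gt0.
  lra.
have r8N : 8 * r <= (2 ^+ N)^-1.
  have : r <= (2 ^+ N)^-1 / 8.
    by near: r; apply: nbhs_right_le; rewrite divr_gt0// invr_gt0 exprn_gt0.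
  lra.
have [|n /andP[n4 n8]] := @dyadic_between R (4 * r).
  by apply/andP; split; lra.
have Nn : (N <= n)%N.
  rewrite leqNgt; apply/negP => nN.
  have : (2 ^+ N)^-1 < (2 ^+ n)^-1 :> R.
    by rewrite ltf_pV2 ?posrE ?exprn_gt0// ltr_eXn2l ?ltr1n.
  lra.
exists (whitney_majorant (truncated_deviation z (2 ^+ n)^-1) n); split.
- by apply: measurable_whitney_majorant; exact: h_ge0.
- by move=> x; apply: whitney_majorant_ge0; exact: h_ge0.
- by move=> x /ballP zx Ox; apply: (deviation_le_majorant Ox Sz zx); lra.
have -> : e = trace_const * (e / trace_const).
  by rewrite mulrCA divff ?gt_eqF// mulr1.
apply: (@le_trans _ _ (\int[mu]_x
    whitney_majorant (truncated_deviation z (2 ^+ n)^-1) n x)%E).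
  apply: ge0_subset_integral => //; first exact: measurable_ballm.
    by apply: measurable_whitney_majorant; exact: h_ge0.
  by move=> x _; apply: whitney_majorant_ge0; exact: h_ge0.
apply: integral_majorant_le => //; [lra|lra|exact: HN].
Unshelve. all: by end_near. Qed.

End CodimensionRegular.

(** * The trace of the extension *)

Section SingletonBoundary.
Context {R : realType} {X : completeMetricType R}.
Variables (Omega : set X) (mu nu : {measure set (borel X) -> \bar R}).
Variables (Cmu p : R) (C : R) (W : whitney Omega Cmu C) (Phi f : X -> R) (z : X).
Hypotheses (Omega_open : open Omega) (Omega_dense : dense Omega).
Hypotheses (mu_ext0 : mu (~` Omega) = 0%E) (mu_doubling : doubling mu Omega Cmu).
Hypotheses (p_ge1 : 1 <= p) (Phi_cutoff : cutoff Omega Phi).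
Hypothesis bdryE : bdry Omega = [set z].

Local Notation S := (bdry Omega).

(** If the boundary is a point of infinite measure, integrability of |f|^p forces
    f(z) = 0, and the average vanishes as well because fine +oo is 0. *)
Lemma waverage_singleton k : windex W k -> nu S != 0%E -> Lp nu S p f ->
  waverage W nu f k = f z.
Proof.
move=> Wk nS0 [_ fp].
have Sz : S z by rewrite bdryE.
have mS : measurable (S : set (borel X)) by exact: measurable_bdry.
have p0 : 0 < p by apply: lt_le_trans p_ge1.
have US : wshadow W k = S.
  apply/seteqP; split => [y []//|y Sy]; split => //; apply/ballP.
  have := wnear_in Wk; move: Sy; rewrite bdryE => -> ->.
  by rewrite mdistxx wradius_gt0.
have fzE y : y \in S -> f y = f z by move=> /set_mem; rewrite bdryE => ->.
rewrite /waverage US.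
have -> : \int[nu]_(y in S) f y = \int[nu]_(y in S) f z by exact: eq_Rintegral.
rewrite Rintegral_cst//.
have [nSoo|nSoo] := eqVneq (nu S) +oo%E; last first.
  have f0 : 0 < fine (nu S) by rewrite fine_gt0// lt0e nS0 measure_ge0 ltey nSoo.
  by rewrite mulrCA mulVf ?mulr1// gt_eqF.
rewrite nSoo /= mulr0 mulr0; apply/esym/eqP; apply: contraLR (fp) => fz0.
rewrite (eq_integral (fun=> (`|f z| `^ p)%:E)); last by move=> y yS; rewrite fzE.
by rewrite integral_cst// nSoo gt0_muley ?ltxx// lte_fin powR_gt0// normr_gt0.
Qed.

Lemma trace_singleton : nu S != 0%E -> Lp nu S p f ->
  trace mu p (whitney_ext W nu Phi f) z = (f z)%:E.
Proof.
move=> nS0 fp; have Sz : S z by rewrite bdryE.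
have p0 : 0 < p by apply: lt_le_trans p_ge1.
apply: (trace_eq Omega_open mu_ext0 p_ge1).
  move=> r r_gt0.
  rewrite (mu_ball_gt0 Omega_open Omega_dense mu_ext0 mu_doubling)//=.
  exact: (mu_ball_lty Omega_open Omega_dense mu_ext0 mu_doubling).
move=> e e0; near=> r; exists (cst 0%E); split => //.
- move=> x /ballP zx Ox.
  have r1 : r <= 1 by near: r; exact: nbhs_right_le.
  have xz : mdist x z <= 1 by rewrite metric_sym; lra.
  rewrite (whitney_ext_near nu W Phi_cutoff f Ox Sz xz).
  have [k [Wk _]] := whitney_ext0_dominated nu W f (f z) Ox.
  rewrite waverage_singleton// subrr normr0 normr_le0 => /eqP ->.
  by rewrite normr0 powR0 // gt_eqF.
- by rewrite integral0 mule_ge0// lee_fin ltW.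
Unshelve. all: by end_near. Qed.

End SingletonBoundary.

Theorem corollary4p22 (R : realType) (X : completeMetricType R) (Omega : set X)
  (mu nu : {measure set (borel X) -> \bar R})
  (Cmu theta alpha p : R) (q : \bar R)
  (C : R) (W : whitney Omega Cmu C) (Phi : X -> R)
  (Omega_dense : dense Omega)
  (Omega_loc_compact : locally_compact [set: set_type Omega])
  (Omega_not_complete : ~ complete_space (set_type Omega))
  (Omega_uniform : uniform_domain Omega)
  (mu_ext0 : mu (~` Omega) = 0%E)
  (mu_doubling : doubling mu Omega Cmu)
  (theta_gt0 : 0 < theta)
  (nu_regular : codim_regular mu nu Omega theta)
  (alpha_gt0 : 0 < alpha) (alpha_lt1 : alpha < 1)
  (p_ge1 : 1 <= p) (q_ge1 : (1 <= q)%E)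
  (exponent_lt1 : alpha + theta / p < 1)
  (Phi_cutoff : cutoff Omega Phi)
  (f : X -> R) (hf : besov nu (bdry Omega) alpha p q f) :
  {ae nu, forall z, bdry Omega z ->
    trace mu p (whitney_ext W nu Phi f) z = (f z)%:E}.
Proof.
have [oOmega _ _] := Omega_uniform.
have [[[f_meas _] f_besov] f_Lp] := hf.
have mS : measurable (bdry Omega : set (borel X)) by exact: measurable_bdry.
have [[x [y [Sx Sy xy]]]|single] :=
    pselect (exists x y, [/\ bdry Omega x, bdry Omega y & x != y]); last first.
  have [[z Sz]|S0] := pselect (exists z, bdry Omega z); last first.
    by apply: aeW => z Sz; case: S0; exists z.
  have bdryE : bdry Omega = [set z].
    apply/seteqP; split => [w Sw|w ->//]; apply/eqP/negPn/negP => wz.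
    by apply: single; exists w, z.
  have [nS0|nS0] := eqVneq (nu (bdry Omega)) 0%E.
    by exists (bdry Omega); split => // w /= /not_implyP[].
  apply: aeW => w; rewrite {1}bdryE => ->.
  exact: (trace_singleton W oOmega Omega_dense mu_ext0 mu_doubling p_ge1
    Phi_cutoff bdryE).
(* The distance of two boundary points is at most the diameter, so regularity
   holds up to the radius r0. *)
pose r0 := mdist x y.
have r0_gt0 : 0 < r0 by rewrite mdist_gt0.
have [Cnu Cnu_ge1 reg] := nu_regular.
have regr z (r : R) : bdry Omega z -> 0 < r -> r <= r0 ->
  ((Cnu^-1 / r `^ theta)%:E * mu (ball z r `&` Omega)
     <= nu (ball z r `&` bdry Omega) /\
   nu (ball z r `&` bdry Omega)
     <= (Cnu / r `^ theta)%:E * mu (ball z r `&` Omega))%E.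
  move=> Sz r_gt0 rr0; apply: reg => //.
  have diam_ge := mdist_le_diam Sx Sy.
  apply: (@le_trans _ _ (2%:E * r0%:E)%E).
    by rewrite -EFinM lee_fin; lra.
  by apply: lee_wpmul2l.
have Cn0 : 0 < Cnu by apply: lt_le_trans Cnu_ge1.
have C0 : 0 < Cmu by have [] := mu_doubling; lra.
have nu_fin z (r : R) : bdry Omega z -> 0 < r -> r <= r0 ->
    (0 < nu (ball z r `&` bdry Omega) < +oo)%E.
  move=> Sz r_gt0 rr0.
  rewrite (nballE oOmega Omega_dense mu_ext0 mu_doubling regr)// lte_fin ltry andbT.
  exact: (nball_gt0 oOmega Omega_dense mu_ext0 mu_doubling Cnu_ge1 regr).
have nu_double z (r : R) : bdry Omega z -> 0 < r -> 2 * r <= r0 ->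
    (nu (ball z (2 * r) `&` bdry Omega)
      <= (Cnu ^+ 2 * Cmu ^+ 3)%:E * nu (ball z r `&` bdry Omega))%E.
  move=> Sz r_gt0 rr0.
  rewrite !(nballE oOmega Omega_dense mu_ext0 mu_doubling regr)//; [|lra|lra].
  rewrite -EFinM lee_fin.
  exact: (nball_double oOmega Omega_dense mu_ext0 mu_doubling theta_gt0 Cnu_ge1 regr).
have D0 : 0 < Cnu ^+ 2 * Cmu ^+ 3 by rewrite mulr_gt0 ?exprn_gt0.
have [a [aS a_dense]] := bdry_sequence W Omega_dense Sx.
have := oscillation_cvg0 mS aS a_dense r0_gt0 nu_fin f_meas D0 nu_double p_ge1
  alpha_gt0 q_ge1 f_besov.
apply: (@filterS _ _ (ae_filter_ringOfSetsType nu)) => z osc0 Sz.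
exact: (trace_whitney_ext oOmega Omega_dense mu_ext0 mu_doubling theta_gt0
  Cnu_ge1 regr W r0_gt0 p_ge1 Phi_cutoff f_meas Sz (osc0 Sz)).
Qed.
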